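(* Consider the actuator-failure setting in the context, with $f$, $g$, $h$ polynomial, and let $d'_1,\ldots,d'_m$ be the relative degrees for the failure patterns $L_1,\ldots,L_m$. The following are equivalent: (a) for every $x$ with $h_j^{d_j}(x)\ge0$ for all $j$ and all $0\le d_j\le d'_j$, there exists $u\in\mathbb R^p$ satisfying the set of $m$ HOCBF constraints $A(x)u\le\Xi(x)$; (b) there exist polynomials $\rho^0_{i,j}(x,y)$, sum-of-squares polynomials $q_S(x,y)$ and nonnegative integers $r_1,\ldots,r_m$, with $y\in\mathbb R^m$, such that $\phi(x,y)+\chi(x,y)+\psi(x,y)=0$ identically, where $$\phi=\sum_{S\subseteq\{1,\ldots,s\}}q_S\prod_{i\in S}\phi_i,\qquad\chi=\prod_{j=1}^m\left(-\Xi^T(x)y\right)^{2r_j},\qquad\psi=\sum_{j=1}^m\sum_{i=1}^p\rho^0_{i,j}\left[A^T(x)y\right]_i,$$ and $\phi_1,\ldots,\phi_s$ is the list consisting of $y_1,\ldots,y_m$, of $-\Xi^T(x)y$, and of $h_j^{d_j}(x)$ for $d_j\in\{0,\ldots,d'_j\}$, $j=1,\ldots,m$ (so $s=m+1+\sum_{j=1}^m(d'_j+1)$).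
   Context: System: $dx_t=(f(x_t)+g(x_t)u^F_t)\,dt$, $x_t\in\mathbb R^n$, $u_t\in\mathbb R^p$, with actuator output $u^F_t=L_ju_t$ under failure pattern $L_j$, $j=1,\ldots,m$; each $L_j$ is a $p\times p$ diagonal 0/1 matrix (zero diagonal entries mark failed actuators), and the system remains controllable under each $L_j$. Safe region $\mathcal C=\{x:h(x)\ge0\}$. High-order functions for pattern $L_j$: $h_j^0=h$, $h_j^{d+1}=\frac{\partial h_j^d}{\partial x}(f(x)+g(x)L_ju)+h_j^d$; $d'_j$ is such that $\frac{\partial h_j^{d'_j}}{\partial x}g(x)L_j\ne0$. Constraint data: $A(x)\in\mathbb R^{m\times p}$ has $j$-th row $-\frac{\partial h_j^{d'_j}}{\partial x}g(x)L_j$, and $\Xi(x)=[\xi_1(x),\ldots,\xi_m(x)]^T$ with $\xi_j(x)=\frac{\partial h_j^{d'_j}}{\partial x}f(x)+h_j^{d'_j}(x)$. *)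

(* Defs.v *)
From HB Require Import structures.
From mathcomp Require Import all_boot all_order all_algebra.
From mathcomp Require Import reals.
From mathcomp Require classical_sets set_interval constructive_ereal.
From mathcomp Require measure lebesgue_measure lebesgue_integral.

Set Implicit Arguments.
Unset Strict Implicit.
Unset Printing Implicit Defensive.

Import Order.TTheory GRing.Theory Num.Theory.
Local Open Scope ring_scope.

(* The measure-theoretic Imports are confined to this module because their
   notations are incompatible with those of mpoly. *)
Module Control.
Import classical_sets set_interval constructive_ereal.
Import measure lebesgue_measure lebesgue_integral.

(* x is a Caratheodory solution on [0, T] of dx/dt = F(x) + G(x) u, for a
   measurable input u; the integral equation also gives the initial value. *)
Definition trajectory (R : realType) (n p : nat)
    (F : 'cV[R]_n -> 'cV[R]_n) (G : 'cV[R]_n -> 'M[R]_(n, p))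
    (T : R) (u : R -> 'cV[R]_p) (x : R -> 'cV[R]_n) (x0 : 'cV[R]_n) : Prop :=
  let velocity (i : 'I_n) (s : R) : R := (F (x s) + G (x s) *m u s) i 0 in
  [/\ forall k : 'I_p,
        measurable_fun (`[0, T]%classic : set R) (fun s => u s k 0),
      forall i : 'I_n,
        (@lebesgue_measure R).-integrable (`[0, T]%classic)
          (fun s => (velocity i s)%:E) &
      forall (t : R) (i : 'I_n), 0 <= t <= T ->
        x t i 0 =
        x0 i 0 + \int[@lebesgue_measure R]_(s in `[0, t]%classic) velocity i s].

Definition controllable (R : realType) (n p : nat)
    (F : 'cV[R]_n -> 'cV[R]_n) (G : 'cV[R]_n -> 'M[R]_(n, p)) : Prop :=
  forall x0 x1 : 'cV[R]_n,
    exists (T : R) (u : R -> 'cV[R]_p) (x : R -> 'cV[R]_n),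
      [/\ 0 <= T, trajectory F G T u x x0 & x T = x1].
End Control.

From mathcomp Require Import mpoly.

Definition failure_pattern (R : realType) (p : nat) (L : 'M[R]_p) : Prop :=
  is_diag_mx L /\ forall k : 'I_p, L k k = 0 \/ L k k = 1.

Section HighOrder.
Variables (R : realType) (n p : nat).
Implicit Types (x : 'cV[R]_n) (u : 'cV[R]_p) (L : 'M[R]_p).

Definition evalmx (a b : nat) (M : 'M[{mpoly R[n]}]_(a, b)) x : 'M[R]_(a, b) :=
  map_mx (fun q : {mpoly R[n]} => q.@[fun i => x i 0]) M.

Definition constmx (a b : nat) (M : 'M[R]_(a, b)) : 'M[{mpoly R[n]}]_(a, b) :=
  map_mx (fun c : R => c%:MP) M.

Definition grad (q : {mpoly R[n]}) : 'rV[{mpoly R[n]}]_n :=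
  \row_(i < n) q^`M(i).

Variables (f : 'cV[{mpoly R[n]}]_n) (g : 'M[{mpoly R[n]}]_(n, p)).

(* The closed-loop right-hand side involves the actuator input u, whereas
   H 0, ..., H d are functions of x alone: the recursion has to hold for every
   value of u, which is possible precisely because the coefficient of u
   vanishes below the relative degree.  It determines H k for k <= d and leaves
   H k free for k > d. *)
Definition high_order_functions (h : {mpoly R[n]}) L (d : nat)
    (H : nat -> {mpoly R[n]}) : Prop :=
  H 0%N = h /\
  forall (k : nat) u, (k < d)%N ->
    H k.+1 = (grad (H k) *m (f + g *m constmx L *m constmx u)) 0 0 + H k.

(* Both (in)equalities are between vectors of polynomials, so that "nonzero"
   means not identically zero in x. *)
Definition relative_degree L (H : nat -> {mpoly R[n]}) (d : nat) : Prop :=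
  (forall k : nat, (k < d)%N -> grad (H k) *m g *m constmx L = 0) /\
  grad (H d) *m g *m constmx L <> 0.

Lemma high_order_functionsE h L d H : relative_degree L H d ->
  high_order_functions h L d H <->
  H 0%N = h /\
  forall k, (k < d)%N -> H k.+1 = (grad (H k) *m f) 0 0 + H k.
Proof.
move=> [LgH0 _]; split=> -[H0 HS]; split=> // k.
  by move=> k_lt; rewrite (HS k 0) // mulmxDr !mulmxA LgH0 // mul0mx addr0.
by move=> u k_lt; rewrite HS // mulmxDr !mulmxA LgH0 // mul0mx addr0.
Qed.

Variables (m : nat) (L : 'I_m -> 'M[R]_p).
Variables (d' : 'I_m -> nat) (H : 'I_m -> nat -> {mpoly R[n]}).

Definition hocbfA : 'M[{mpoly R[n]}]_(m, p) :=
  \matrix_(j < m, k < p) (- (grad (H j (d' j)) *m g *m constmx (L j)) 0 k).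

Definition hocbfXi : 'cV[{mpoly R[n]}]_m :=
  \col_(j < m) ((grad (H j (d' j)) *m f) 0 0 + H j (d' j)).

(* In {mpoly R[n + m]} the first n variables are x and the last m are y. *)
Definition liftx (q : {mpoly R[n]}) : {mpoly R[n + m]} :=
  q \mPo [tuple 'X_(lshift m i) | i < n].

Definition yvar : 'cV[{mpoly R[n + m]}]_m := \col_(j < m) 'X_(rshift n j).

Definition ATy : 'cV[{mpoly R[n + m]}]_p := (map_mx liftx hocbfA)^T *m yvar.
Definition negXiTy : {mpoly R[n + m]} :=
  - ((map_mx liftx hocbfXi)^T *m yvar) 0 0.

Definition phis : seq {mpoly R[n + m]} :=
  [seq yvar j 0 | j <- enum 'I_m] ++
  negXiTy ::
  flatten [seq [seq liftx (H j k) | k <- iota 0 (d' j).+1] | j <- enum 'I_m].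

Lemma size_phis : size phis = (m + 1 + \sum_(j < m) (d' j).+1)%N.
Proof.
rewrite /phis size_cat /= size_map size_enum_ord -addnA add1n; congr (_ + _.+1)%N.
rewrite size_flatten /shape -map_comp sumnE big_map big_enum /=.
by apply: eq_bigr => j _; rewrite size_map size_iota.
Qed.

End HighOrder.

Definition sum_of_squares (R : realType) (n : nat) (q : {mpoly R[n]}) : Prop :=
  exists s : seq {mpoly R[n]}, q = \sum_(a <- s) a ^+ 2.

(* Main.v *)
Require Import Defs.
From HB Require Import structures.
From mathcomp Require Import all_boot all_order all_algebra.
From mathcomp Require Import reals mpoly.
From mathcomp Require Import generic_quotient ring_quotient fraction.
From mathcomp Require Import polyrcf qe_rcf_th ring lra zify.
From mathcomp Require boolp classical_sets filter.

Set Implicit Arguments.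
Unset Strict Implicit.
Unset Printing Implicit Defensive.

Import Order.TTheory GRing.Theory Num.Theory.
Local Open Scope ring_scope.

(* By Farkas' lemma, u fails to exist at x exactly when some y >= 0 has
   A(x)^T y = 0 and - Xi(x)^T y > 0, so (a) says that the system phi_i >= 0,
   A^T y = 0, Xi^T y <> 0 has no real solution (x, y); (b) is a Krivine-
   Stengle certificate of that, in which the r_j only matter through their
   sum.

   If there is no certificate, Zorn's lemma yields a prime cone of the
   polynomial ring containing the phi_i and +-(A^T y)_i but not - (Xi^T y)^2,
   hence an ordered field in which the system is solvable. This field embeds
   into a real closed one: a term language with names for roots is
   interpreted, finitely many terms at a time, in finite towers of ordered
   extensions, and the ultraproduct of these interpretations yields a real
   closed field. Solvability descends from there to R one variable at a time,
   because the sign conditions realised by univariate polynomials over a real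
   closed field are determined, through Cauchy indices and Euclidean
   division, by the signs of finitely many polynomials in their coefficients. *)

(** * Farkas' lemma *)

Section Farkas.
Variable R : realFieldType.

(** Supplies the value of the eliminated variable in Fourier-Motzkin elimination; either list of
    bounds may be empty. *)
Lemma exists_between (lo hi : seq R) :
  {in lo & hi, forall l h, l <= h} ->
  exists t, {in lo, forall l, l <= t} /\ {in hi, forall h, t <= h}.
Proof.
elim: lo => [_|l lo IHlo lohi].
  elim: hi => [|h hi [t [_ thi]]]; first by exists 0.
  exists (Num.min h t); split=> // x; rewrite inE ge_min => /orP[/eqP->|/thi->].
    by rewrite lexx.
  by rewrite orbT.
have [|t [lot thi]] := IHlo.
  by move=> x h xlo hhi; apply: lohi; rewrite // inE xlo orbT.
exists (Num.max l t); split=> x; rewrite ?inE ?le_max ?ge_max.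
  by move=> /orP[/eqP->|/lot->]; rewrite ?lexx ?orbT.
by move=> xhi; rewrite thi // andbT lohi // inE eqxx.
Qed.

Section Elimination.
Variable p : nat.
Implicit Types (c d : 'rV[R]_p * R) (u : 'cV[R]_p).

Definition slack u c : R := c.2 - (c.1 *m u) 0 0.

(** A pair [c] encodes the inequality c.1 u <= c.2, and only the first [k] variables still occur.
    The last of them is eliminated by adding positive multiples of an inequality in which its
    coefficient is positive and of one in which it is negative. [C] stands for the inequalities
    derivable from the original ones, so that no multipliers have to be carried along. *)
Lemma fourier_motzkin (C : 'rV[R]_p * R -> Prop) :
  (forall c d, C c -> C d -> C (c.1 + d.1, c.2 + d.2)) ->
  (forall (a : R) c, 0 <= a -> C c -> C (a *: c.1, a * c.2)) ->
  forall (k : nat) (s : seq ('rV[R]_p * R)),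
  {in s, forall c, C c /\ forall i : 'I_p, (k <= i)%N -> c.1 0 i = 0} ->
  (exists u, {in s, forall c, 0 <= slack u c}) \/ exists2 b, b < 0 & C (0, b).
Proof.
move=> CD CZ; elim=> [|k IHk] s sk.
  have s0 c : c \in s -> c.1 = 0.
    by move=> /sk[_ c0]; apply/rowP => i; rewrite mxE c0.
  have [/allP sP|/allPn[c cs cN]] := boolP (all (fun c => 0 <= c.2) s).
    by left; exists 0 => c /sP; rewrite /slack mulmx0 mxE subr0.
  right; exists c.2; first by rewrite ltNge.
  by rewrite -(s0 c cs) -surjective_pairing; have [] := sk c cs.
have [pk|kp] := leqP p k.
  by apply: IHk => c /sk[cC _]; split=> // i /(leq_trans pk);
    rewrite leqNgt ltn_ord.
pose i0 := Ordinal kp; pose co c : R := c.1 0 i0.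
pose combine c d : 'rV[R]_p * R :=
  ((- co d) *: c.1 + co c *: d.1, (- co d) * c.2 + co c * d.2).
pose s' := [seq c <- s | co c == 0] ++
  [seq combine c d | c <- [seq c <- s | 0 < co c], d <- [seq d <- s | co d <
    0]].
have [|[u us']|] := IHk s'; last by right.
  move=> c; rewrite mem_cat => /orP[|/allpairsP[[c' d']]].
    rewrite mem_filter => /andP[/eqP c0 /sk[cC ck]]; split=> // i.
    rewrite leq_eqVlt => /orP[/eqP ki|/ck//].
    by rewrite -c0; congr (c.1 0 _); apply: val_inj.
  rewrite /= !mem_filter => -[/andP[c0 /sk[cC ck]] /andP[d0 /sk[dC dk]] ->].
  split.
    have cC' : C (- co d' *: c'.1, - co d' * c'.2) by apply: CZ;
      rewrite ?oppr_ge0 ?ltW.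
    have dC' : C (co c' *: d'.1, co c' * d'.2) by apply: CZ; rewrite ?ltW.
    exact: CD cC' dC'.
  move=> i; rewrite leq_eqVlt => /orP[/eqP ki|ki]; rewrite !mxE.
    have -> : i = i0 by apply: val_inj.
    by rewrite -/(co c') -/(co d'); ring.
  by rewrite ck // dk // !mulr0 addr0.
left.
(* Moving [u] by [t] along coordinate [i0] lowers the slack of [c] by [co c * t]: negative
   coefficients bound [t] from below, positive ones from above. The combined inequalities say that
   each lower bound is at most each upper bound. *)
have [|t [lot thi]] := @exists_between
    [seq slack u d / co d | d <- s & co d < 0]
    [seq slack u c / co c | c <- s & 0 < co c].
  move=> _ _ /mapP[d + ->] /mapP[c + ->].
  rewrite !mem_filter => /andP[d0 ds] /andP[c0 cs].
  have /us' : combine c d \in s'.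
    rewrite mem_cat; apply/orP; right; apply/allpairsP; exists (c, d).
    by rewrite /= !mem_filter c0 d0.
  rewrite ler_pdivlMr // mulrAC ler_ndivrMr //.
  by rewrite /slack /= mulmxDl -!scalemxAl !mxE; lra.
exists (u + t *: delta_mx i0 0) => c cs.
have -> : slack (u + t *: delta_mx i0 0) c = slack u c - co c * t.
  by rewrite /slack mulmxDr -scalemxAr -colE !mxE opprD addrA [t * _]mulrC.
case: (ltrgt0P (co c)) => [c0|c0|c0].
- rewrite subr_ge0 mulrC -ler_pdivlMr // thi //.
  by apply/mapP; exists c; rewrite // mem_filter c0.
- rewrite subr_ge0 mulrC -ler_ndivrMr // lot //.
  by apply/mapP; exists c; rewrite // mem_filter c0.
rewrite c0 mul0r subr0; apply: us'.
by rewrite mem_cat mem_filter cs c0 eqxx.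
Qed.

End Elimination.

Lemma farkas m p (A : 'M[R]_(m, p)) (b : 'cV[R]_m) :
  (exists u : 'cV_p, forall j, (A *m u) j 0 <= b j 0) \/
  exists y : 'cV_m, [/\ forall j, 0 <= y j 0, A^T *m y = 0 &
    (b^T *m y) 0 0 < 0].
Proof.
(* [C] collects the combinations of the rows with multipliers y >= 0; a derived inequality 0 <= a
   with a < 0 is then the second alternative. *)
pose C (c : 'rV[R]_p * R) := exists y : 'cV_m, [/\ forall j, 0 <= y j 0,
  (A^T *m y)^T = c.1 & (b^T *m y) 0 0 = c.2].
have CD c d : C c -> C d -> C (c.1 + d.1, c.2 + d.2).
  move=> [y [y0 Ay yb]] [z [z0 Az zb]]; exists (y + z); split=> [j||] /=.
  - by rewrite mxE addr_ge0.
  - by rewrite mulmxDr linearD /= Ay Az.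
  by rewrite mulmxDr mxE yb zb.
have CZ (a : R) c : 0 <= a -> C c -> C (a *: c.1, a * c.2).
  move=> a0 [y [y0 Ay yb]]; exists (a *: y); split=> [j||] /=.
  - by rewrite mxE mulr_ge0.
  - by rewrite -scalemxAr linearZ /= Ay.
  by rewrite -scalemxAr mxE yb.
have [|[u uP]|[a a0 [y [y0 Ay yb]]]] :=
    fourier_motzkin CD CZ (k := p) (s :=
      [seq (row j A, b j 0) | j <- enum 'I_m]).
- move=> _ /mapP[j _ ->]; split=> [|i]; last by rewrite leqNgt ltn_ord.
  exists (delta_mx j 0); split=> [i||] /=.
  + by rewrite mxE; case: (_ && _); rewrite ?ler01.
  + by rewrite -colE -tr_row trmxK.
  by rewrite -colE !mxE.
- left; exists u => j; rewrite -subr_ge0.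
  have /uP : (row j A, b j 0) \in [seq (row j A, b j 0) | j <- enum 'I_m].
    by apply: map_f; rewrite mem_enum.
  by rewrite /slack /= -row_mul mxE.
right; exists y; split=> //; last by rewrite yb.
by rewrite -[LHS]trmxK Ay trmx0.
Qed.

End Farkas.

(** * Prime cones and ordered fields *)

Section OrderedField.
Variables (F : fieldType) (nonneg : pred F).
Hypothesis nonnegD : forall x y, nonneg x -> nonneg y -> nonneg (x + y).
Hypothesis nonnegM : forall x y, nonneg x -> nonneg y -> nonneg (x * y).
Hypothesis nonneg_anti : forall x, nonneg x -> nonneg (- x) -> x = 0.
Hypothesis nonneg_total : forall x, nonneg x || nonneg (- x).

Let le x y := nonneg (y - x).
Let lt x y := (y != x) && le x y.
Let norm x := if nonneg x then x else - x.

Let le0D x y : le 0 x -> le 0 y -> le 0 (x + y).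
Proof. by rewrite /le !subr0; apply: nonnegD. Qed.
Let le0M x y : le 0 x -> le 0 y -> le 0 (x * y).
Proof. by rewrite /le !subr0; apply: nonnegM. Qed.
Let le0_anti x : le 0 x -> le x 0 -> x = 0.
Proof. by rewrite /le subr0 sub0r; apply: nonneg_anti. Qed.
Let subr_le0 x y : le 0 (y - x) = le x y.
Proof. by rewrite /le subr0. Qed.
Let le0_total x : le 0 x || le x 0.
Proof. by rewrite /le subr0 sub0r; apply: nonneg_total. Qed.
Let normN x : norm (- x) = norm x.
Proof.
rewrite /norm opprK; case: ifPn => xN; case: ifPn => xP //.
  by rewrite (nonneg_anti xP xN) oppr0.
by have := nonneg_total x; rewrite (negbTE xN) (negbTE xP).
Qed.
Let ge0_norm x : le 0 x -> norm x = x.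
Proof. by rewrite /le subr0 /norm => ->. Qed.

Definition ordered_field : realFieldType :=
  HB.pack_for realFieldType (F : Type) (GRing.Field.on F)
    (Num.IntegralDomain_isLeReal.Build F le0D le0M le0_anti subr_le0 le0_total
       normN ge0_norm (fun _ _ => erefl)).

Lemma ordered_field_ge0 (x : F) : (0 <= x :> ordered_field) = nonneg x.
Proof. by rewrite -[LHS]/(nonneg (x - 0)) subr0. Qed.

End OrderedField.

(** Lets every element of the residue field be written as a quotient of images of ring elements. *)
Lemma fraction_of_ratio (D : idomainType) (r : {ratio D}) :
  \pi_({fraction D})%qT r = FracField.tofrac (\n_r) / FracField.tofrac (\d_r).
Proof.
have d0 : FracField.tofrac (\d_r) != 0 by rewrite tofrac_eq0 denom_ratioP.
apply: (mulIf d0); rewrite divfK //; unlock FracField.tofrac.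
rewrite -[LHS]FracField.pi_mul; apply/eqmodP; rewrite /= FracField.equivfE.
rewrite /FracField.mulf !numden_Ratio ?mulf_neq0 ?oner_neq0 ?denom_ratioP //.
by rewrite !mulr1 mulrC.
Qed.

(** * The ordered residue field of a prime cone *)

Section PrimeCone.
Variable A : comNzRingType.
Implicit Types (P : A -> Prop) (a b c : A).

(** Properness is imposed separately, by [prime_coneN1] or by [avoids]. *)
Record cone P : Prop := Cone {
  coneD : forall a b, P a -> P b -> P (a + b);
  coneM : forall a b, P a -> P b -> P (a * b);
  cone_sqr : forall a, P (a ^+ 2)
}.

Definition support P a := P a /\ P (- a).

(** The points of the real spectrum of [A]: the support is a prime ideal, and [P] induces a total
    order on the fraction field of the quotient by it. *)
Record prime_cone P : Prop := PrimeCone {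
  prime_cone_cone :> cone P;
  prime_coneN1 : ~ P (- 1);
  prime_cone_total : forall a, P a \/ P (- a);
  prime_cone_support : forall a b,
    support P (a * b) -> support P a \/ support P b
}.

Section Support.
Variables (P : A -> Prop) (Pprime : prime_cone P).

Lemma cone0 : P 0.
Proof. by have := cone_sqr Pprime 0; rewrite expr0n. Qed.

Lemma support_mulr a b : support P a -> support P (b * a).
Proof.
move=> [aP aN]; have [bP|bN] := prime_cone_total Pprime b.
  by split; [|rewrite -mulrN]; apply: (coneM Pprime).
by split; [rewrite -mulrNN|rewrite -mulNr]; apply: (coneM Pprime).
Qed.

Lemma supportD a b : support P a -> support P b -> support P (a + b).
Proof.
by move=> [aP aN] [bP bN]; split; rewrite ?opprD; apply: (coneD Pprime).
Qed.

Section ConeField.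
Variables (K : fieldType) (proj : {rmorphism A -> K}).
Hypothesis proj_eq0P : forall a, proj a = 0 <-> support P a.
Hypothesis proj_frac : forall x, exists a b,
  proj b != 0 /\ x = proj a / proj b.

Let cone_proj a b : proj a = proj b -> P a -> P b.
Proof.
move=> ab aP; have [ba _] : support P (b - a).
  by apply/proj_eq0P; rewrite rmorphB ab subrr.
by rewrite -(subrK a b); apply: (coneD Pprime).
Qed.

(** If instead - a is in [P], then b^2 a lies in the support, and so does a because [proj b] is
    nonzero in the field [K]. *)
Let cone_sqr_mul a b : proj b != 0 -> P (b ^+ 2 * a) -> P a.
Proof.
move=> b0 ba; have [//|aN] := prime_cone_total Pprime a.
suff [] : support P a by [].
apply/proj_eq0P/eqP; have : proj (b ^+ 2 * a) = 0.
  apply/proj_eq0P; split=> //; rewrite -mulrN.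
  by apply: (coneM Pprime) => //; apply: (cone_sqr Pprime).
by rewrite rmorphM rmorphXn => /eqP; rewrite mulf_eq0 sqrf_eq0 (negbTE b0).
Qed.

(** The quotient a / b has the sign of a b, from which it differs by the square of b; [nonnegP]
    shows that the choice of a and b does not matter. *)
Let nonneg (x : K) : bool := boolp.asbool
  (exists a b, [/\ proj b != 0, x = proj a / proj b & P (a * b)]).

Let nonnegP a b : proj b != 0 -> nonneg (proj a / proj b) <-> P (a * b).
Proof.
move=> b0; split=> [/boolp.asboolP[c [d [d0 e cdP]]]|abP]; last first.
  by apply/boolp.asboolP; exists a, b.
(* From a / b = c / d, the elements d^2 (a b) and b^2 (c d) have the same image in [K]. *)
apply: (cone_sqr_mul d0);
  apply: cone_proj (coneM Pprime (cone_sqr Pprime b) cdP).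
have {}e : proj a * proj d = proj c * proj b.
  by apply/eqP; rewrite -eqr_div // e.
rewrite !(rmorphM, rmorphXn) /= !expr2.
have -> : proj b * proj b * (proj c * proj d) =
  (proj c * proj b) * (proj b * proj d) by ring.
by rewrite -e; ring.
Qed.

Let nonnegD x y : nonneg x -> nonneg y -> nonneg (x + y).
Proof.
have [a [b [b0 ->]]] := proj_frac x; have [c [d [d0 ->]]] := proj_frac y.
move=> /(nonnegP _ b0) abP /(nonnegP _ d0) cdP.
have bd0 : proj (b * d) != 0 by rewrite rmorphM mulf_neq0.
rewrite addf_div // -!rmorphM -rmorphD; apply/(nonnegP _ bd0).
rewrite (_ : _ * _ = d ^+ 2 * (a * b) + b ^+ 2 * (c * d)).
  by apply: (coneD Pprime); apply: (coneM Pprime) => //;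
    apply: (cone_sqr Pprime).
by rewrite mulrDl !expr2 !mulrA; congr (_ + _); ring.
Qed.

Let nonnegM x y : nonneg x -> nonneg y -> nonneg (x * y).
Proof.
have [a [b [b0 ->]]] := proj_frac x; have [c [d [d0 ->]]] := proj_frac y.
move=> /(nonnegP _ b0) abP /(nonnegP _ d0) cdP.
have bd0 : proj (b * d) != 0 by rewrite rmorphM mulf_neq0.
rewrite mulf_div -!rmorphM; apply/(nonnegP _ bd0).
by rewrite mulrACA; apply: (coneM Pprime).
Qed.

Let nonneg_anti x : nonneg x -> nonneg (- x) -> x = 0.
Proof.
have [a [b [b0 ->]]] := proj_frac x.
rewrite -mulNr -rmorphN => /(nonnegP _ b0) abP /(nonnegP _ b0).
rewrite mulNr => abN; suff -> : proj a = 0 by rewrite mul0r.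
have /eqP : proj (a * b) = 0 by apply/proj_eq0P.
by rewrite rmorphM mulf_eq0 (negbTE b0) orbF => /eqP.
Qed.

Let nonneg_total x : nonneg x || nonneg (- x).
Proof.
have [a [b [b0 ->]]] := proj_frac x.
have [abP|abN] := prime_cone_total Pprime (a * b).
  by apply/orP; left; apply/(nonnegP _ b0).
by apply/orP; right; rewrite -mulNr -rmorphN; apply/(nonnegP _ b0);
  rewrite mulNr.
Qed.

Lemma cone_ordered_field : exists (F : realFieldType) (h : {rmorphism A -> F}),
  forall a, 0 <= h a <-> P a.
Proof.
exists (ordered_field nonnegD nonnegM nonneg_anti nonneg_total), proj => a.
rewrite ordered_field_ge0.
have one0 : proj 1 != 0 by rewrite rmorph1 oner_neq0.
by have := nonnegP a one0; rewrite rmorph1 divr1 mulr1.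
Qed.

End ConeField.

(* The proof argument lets the ideal instances declared below depend on it. *)
Definition support_pred (_ : prime_cone P) : A -> bool :=
  fun a => boolp.asbool (support P a).
Local Notation I := (support_pred Pprime).

Lemma support_ideal : idealr_closed I.
Proof.
split=> [||a x y]; rewrite !unfold_in.
- by apply/boolp.asboolP; split; rewrite ?oppr0; apply: cone0.
- by apply/boolp.asboolPn => -[_]; apply: prime_coneN1.
move=> /boolp.asboolP xs /boolp.asboolP ys; apply/boolp.asboolP.
by apply: supportD => //; apply: support_mulr.
Qed.

HB.instance Definition _ := isIdealr.Build A I support_ideal.

Lemma support_prime : prime_idealr_closed I.
Proof.
move=> x y; rewrite !unfold_in => /boolp.asboolP /(prime_cone_support Pprime).
by case=> h; apply/orP; [left|right]; apply/boolp.asboolP.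
Qed.

HB.instance Definition _ :=
  isPrimeIdealrClosed.Build A I support_prime.

Definition support_prime_ideal : prime_idealr A := HB.pack I.

Definition residue_ring : Type := {ideal_quot support_prime_ideal}.
HB.instance Definition _ := GRing.ComNzRing.on residue_ring.

(** Forming fractions requires an integral domain with a boolean unit test and an inverse function;
    classical choice provides both. *)
Let is_unit (x : residue_ring) : bool := boolp.asbool (exists y, y * x = 1).
Let inv (x : residue_ring) : residue_ring :=
  if is_unit x then classical_sets.xget 0 (fun y => y * x = 1) else x.

Let mulVx : {in is_unit, left_inverse 1 inv *%R}.
Proof.
move=> x xu; have {}xu : is_unit x := xu; rewrite /inv xu.
by move/boolp.asboolP: xu => /(classical_sets.xgetPex 0).
Qed.
Let unitPl x y : y * x = 1 -> is_unit x.
Proof. by move=> yx; apply/boolp.asboolP; exists y. Qed.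
Let inv_out : {in [predC is_unit], inv =1 id}.
Proof. by move=> x xu; rewrite /inv; have /negbTE-> : ~~ is_unit x := xu. Qed.

HB.instance Definition _ := GRing.ComNzRing_hasMulInverse.Build residue_ring
  mulVx unitPl inv_out.
HB.instance Definition _ := GRing.ComUnitRing_isIntegral.Build residue_ring
  (@Quotient.rquot_IdomainAxiom A support_prime_ideal).

Definition residue_field : fieldType := {fraction residue_ring}.
Definition residue : {rmorphism A -> residue_field} :=
  @FracField.tofrac residue_ring \o \pi_residue_ring%qT.

Lemma residue_eq0 a : (residue a == 0) = boolp.asbool (support P a).
Proof.
rewrite /= tofrac_eq0 -(rmorph0 (\pi_residue_ring%qT)) -Quotient.idealrBE.
by rewrite subr0.
Qed.

Lemma prime_cone_field : exists (F : realFieldType) (h : {rmorphism A -> F}),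
  forall a, 0 <= h a <-> P a.
Proof.
apply: (@cone_ordered_field residue_field residue) => [a|x].
  split=> [/eqP|h]; first by rewrite residue_eq0 => /boolp.asboolP.
  by apply/eqP; rewrite residue_eq0; apply/boolp.asboolP.
elim/quotW: x => r; exists (repr \n_r), (repr \d_r); rewrite /= !reprK.
by rewrite tofrac_eq0 denom_ratioP -fraction_of_ratio.
Qed.

End Support.
End PrimeCone.

(** * Maximal cones are prime *)

Section PrimeConeExtension.
Variables (A : comNzRingType) (g : A).
Implicit Types (P : A -> Prop) (a b c : A).

(** The case k = 0 excludes -1. All even powers are excluded together because exponents add up when
    two relations are multiplied. *)
Definition avoids P := forall k, ~ P (- (g ^+ (2 * k))).

Lemma even_pow_sqr k : g ^+ (2 * k) = (g ^+ k) ^+ 2.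
Proof. by rewrite mulnC exprM. Qed.

Section Maximal.
Variables (M : A -> Prop) (Mcone : cone M) (Mavoids : avoids M).
Hypothesis Mmax : forall P, cone P -> avoids P -> (forall a, M a -> P a) ->
  forall a, P a -> M a.

(** The cone generated by [M] and [a]: since a^2 is in [M], no higher power of [a] is needed. *)
Let adjoin a b := exists p q, [/\ M p, M q & b = p + a * q].

Let M0 : M 0.
Proof. by have := cone_sqr Mcone 0; rewrite expr0n. Qed.
Let M1 : M 1.
Proof. by have := cone_sqr Mcone 1; rewrite expr1n. Qed.
Let Meven k : M (g ^+ (2 * k)).
Proof. by rewrite even_pow_sqr; apply: (cone_sqr Mcone). Qed.

Let Msqr_mul a b c : M b -> M c -> M (a ^+ 2 * (b * c)).
Proof.
move=> bM cM; apply: (coneM Mcone); first exact: (cone_sqr Mcone).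
exact: (coneM Mcone).
Qed.

Let adjoin_cone a : cone (adjoin a).
Proof.
split=> [_ _ [p [q [pM qM ->]]] [p' [q' [pM' qM' ->]]] |
         _ _ [p [q [pM qM ->]]] [p' [q' [pM' qM' ->]]] | b].
- exists (p + p'), (q + q'); split; [exact: (coneD Mcone)..|].
  by rewrite mulrDr addrACA.
- exists (p * p' + a ^+ 2 * (q * q')), (p * q' + q * p'); split; last by ring.
    by apply: (coneD Mcone); [apply: (coneM Mcone)|apply: Msqr_mul].
  by apply: (coneD Mcone); apply: (coneM Mcone).
by exists (b ^+ 2), 0; rewrite mulr0 addr0; split=> //; apply: (cone_sqr Mcone).
Qed.

Let notin_maximal a : ~ M a ->
  exists k p q, [/\ M p, M q & - (g ^+ (2 * k)) = p + a * q].
Proof.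
move=> aM; apply: boolp.contrapT => no; apply: aM.
apply: (Mmax (adjoin_cone a)) => [k [p [q h]]|b bM|].
- by apply: no; exists k, p, q.
- by exists b, 0; rewrite mulr0 addr0.
by exists 0, 1; rewrite mulr1 add0r.
Qed.

(* Multiply g^(2k) + p = - a q by g^(2l) + p' = a q'. *)
Let maximal_total a : M a \/ M (- a).
Proof.
apply: boolp.contrapT => /boolp.not_orP[/notin_maximal[k [p [q [pM qM e]]]]].
move=> /notin_maximal[l [p' [q' [pM' qM' e']]]].
apply: (Mavoids (k := (k + l)%N)).
have -> : - g ^+ (2 * (k + l)) = g ^+ (2 * k) * p' + p * g ^+ (2 * l) + p * p'
    + a ^+ 2 * (q * q').
  have {}e : a * q = - (g ^+ (2 * k)) - p by rewrite e; ring.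
  have {}e' : - a * q' = - (g ^+ (2 * l)) - p' by rewrite e'; ring.
  have -> : a ^+ 2 * (q * q') = - ((a * q) * (- a * q')) by ring.
  by rewrite e e' mulnDr exprD; ring.
by do 3?apply: (coneD Mcone); do 1?[exact: Msqr_mul];
  apply: (coneM Mcone).
Qed.

(** Otherwise g^(2k) + p = a q and g^(2l) + p' = b q'; in the product of the two, - a b q q' belongs
    to [M], which puts - g^(2(k+l)) in [M]. *)
Let maximal_support a b : M (- (a * b)) -> M a -> M b -> M (- a) \/ M (- b).
Proof.
move=> abN aM bM.
apply: boolp.contrapT => /boolp.not_orP[/notin_maximal[k [p [q [pM qM e]]]]].
move=> /notin_maximal[l [p' [q' [pM' qM' e']]]].
apply: (Mavoids (k := (k + l)%N)).
have -> : - g ^+ (2 * (k + l)) = g ^+ (2 * k) * p' + p * g ^+ (2 * l) + p * p'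
    + (- (a * b)) * (q * q').
  have {}e : a * q = g ^+ (2 * k) + p by rewrite -[g ^+ _]opprK e; ring.
  have {}e' : b * q' = g ^+ (2 * l) + p' by rewrite -[g ^+ (2 * l)]opprK e';
    ring.
  have -> : (- (a * b)) * (q * q') = - ((a * q) * (b * q')) by ring.
  by rewrite e e' mulnDr exprD; ring.
by do 3?apply: (coneD Mcone); do 2?apply: (coneM Mcone).
Qed.

(** Primality of the support reduces to [maximal_support] by changing the signs of a and b until
    both lie in [M]. *)
Lemma maximal_prime_cone : prime_cone M.
Proof.
split=> // [|a b].
- by have := Mavoids (k := 0); rewrite muln0 expr0.
have supp x : M x -> M (- x) -> support M x by split.
have suppN x : support M (- x) -> support M x by case; rewrite opprK.
move=> [abM abN]; case: (maximal_total a) => aM; case: (maximal_total b) => bM.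
- by case: (maximal_support abN aM bM); [left|right].
- case: (@maximal_support a (- b)) => //; first by rewrite mulrN opprK.
    by left.
  by right; apply: suppN.
- case: (@maximal_support (- a) b) => //; first by rewrite mulNr opprK.
    by left; apply: suppN.
  by right.
case: (@maximal_support (- a) (- b)); rewrite ?mulrNN //.
  by left; apply: suppN.
by right; apply: suppN.
Qed.

End Maximal.

Lemma prime_cone_extension P0 : cone P0 -> avoids P0 ->
  exists P, [/\ forall a, P0 a -> P a, prime_cone P & ~ P (- (g ^+ 2))].
Proof.
move=> P0cone P0avoids.
pose ok P := (forall a, ~ P a) \/
  [/\ forall a, P0 a -> P a, cone P & avoids P].
have [F okF chainF|M [Mok Mmax]] := @classical_sets.Zorn_bigcup A ok.
  have [[P [FP [a Pa]]]|none] :=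
      boolp.EM (exists P, F P /\ exists a, P a); last first.
    by left=> a [P FP Pa]; apply: none; exists P; split=> //; exists a.
  have okP Q : F Q -> (exists a, Q a) ->
      [/\ forall a, P0 a -> Q a, cone Q & avoids Q].
    by move=> /okF[no [c /no//]|//].
  right; split.
  - by move=> b bP0; exists P => //;
    have [+ _ _] := okP P FP (ex_intro _ a Pa); apply.
  - have common b c : classical_sets.bigcup F id b ->
    classical_sets.bigcup F id c ->
        exists Q, [/\ F Q, Q b & Q c].
      move=> [Q FQ Qb] [Q' FQ' Qc]; case: (chainF Q Q' FQ FQ') => sQ.
        by exists Q'; split=> //; apply: sQ.
      by exists Q; split=> //; apply: sQ.
    split=> [b c bF cF|b c bF cF|b].
    + have [Q [FQ Qb Qc]] := common b c bF cF; exists Q => //.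
      by have [_ cQ _] := okP Q FQ (ex_intro _ b Qb); apply: (coneD cQ).
    + have [Q [FQ Qb Qc]] := common b c bF cF; exists Q => //.
      by have [_ cQ _] := okP Q FQ (ex_intro _ b Qb); apply: (coneM cQ).
    by exists P => //; have [_ cP _] := okP P FP (ex_intro _ a Pa);
      apply: (cone_sqr cP).
  move=> k [Q FQ Qk]; have [_ _ aQ] := okP Q FQ (ex_intro _ _ Qk).
  exact: (aQ k).
case: Mok => [M0|[P0M Mcone Mavoids]].
  (* The empty set is not maximal, since [P0] is strictly larger. *)
  exfalso; apply: (Mmax P0); last by right.
  split=> [a /M0//|/(_ 0) h]; apply: (M0 0); apply: h.
  by have := cone_sqr P0cone 0; rewrite expr0n.
exists M; split=> //; last by have := Mavoids 1%N; rewrite muln1.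
apply: maximal_prime_cone => // P cP aP MP a Pa; apply: boolp.contrapT => aM.
apply: (Mmax P); last by right; split=> // b /P0M/MP.
by split=> // /(_ a Pa).
Qed.

End PrimeConeExtension.

(** * Adjoining a root *)

Section RootExtension.
Variable K : realFieldType.
Implicit Types (p q r s : {poly K}).

(** Nonnegative weights are allowed because a nonnegative element of [K] need not be a square, yet
    has to stay nonnegative in the extension. *)
Inductive weighted_sos : {poly K} -> Prop :=
| wsos0 : weighted_sos 0
| wsos_add c q s :
    0 <= c -> weighted_sos s -> weighted_sos (c *: q ^+ 2 + s).

Lemma wsosD s t : weighted_sos s -> weighted_sos t -> weighted_sos (s + t).
Proof.
move=> + tP; elim=> [|c q u c0 _ IHu]; first by rewrite add0r.
by rewrite -addrA; apply: wsos_add.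
Qed.

Lemma wsosM s t : weighted_sos s -> weighted_sos t -> weighted_sos (s * t).
Proof.
move=> + tP; elim=> [|c q u c0 _ IHu]; first by rewrite mul0r; apply: wsos0.
rewrite mulrDl; apply: wsosD IHu.
elim: tP => [|d v w d0 _ IHw]; first by rewrite mulr0; apply: wsos0.
rewrite mulrDr; apply: wsosD IHw; rewrite -scalerAl -scalerAr scalerA -exprMn.
by rewrite -[X in weighted_sos X]addr0; apply: wsos_add wsos0; rewrite mulr_ge0.
Qed.

Lemma wsos_horner_ge0 s x : weighted_sos s -> 0 <= s.[x].
Proof.
elim=> [|c q t c0 _ IHt]; first by rewrite horner0.
by rewrite hornerD hornerZ horner_exp addr_ge0 // mulr_ge0 // sqr_ge0.
Qed.

(** Each square is replaced by the square of the remainder modulo [p], of degree at most 2 (deg p -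
    1) if the remainder is nonzero. *)
Lemma wsos_mod p s : p != 0 -> weighted_sos s ->
  exists s' t, [/\ weighted_sos s', s = s' + p * t &
    (size s' <= (size p).-1.*2.-1)%N].
Proof.
move=> p0; elim=> [|c q u c0 _ [u' [t [u'P -> su']]]].
  by exists 0, 0; rewrite mulr0 addr0 size_poly0; split=> //; apply: wsos0.
exists (c *: (q %% p) ^+ 2 + u').
exists (c *: ((q %/ p) ^+ 2 * p + (q %/ p) * (q %% p) *+ 2) + t).
split; first exact: wsos_add.
  by rewrite {1}(divp_eq q p) -!mul_polyC; ring.
apply: leq_trans (size_polyD _ _) _; rewrite geq_max su' andbT.
have [->|qp0] := eqVneq (q %% p) 0; first by rewrite expr0n scaler0 size_poly0.
apply: leq_trans (size_scale_leq _ _) _.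
apply: leq_trans (size_exp_leq _ _) _.
have : (size (q %% p)%R < size p)%N by rewrite ltn_modp.
move: qp0; rewrite -size_poly_gt0.
by move: (size (q %% p)%R) (size p) => u1 v1; lia.
Qed.

(* Reducing the squares modulo [p] makes the cofactor [r] of smaller degree,
   and [p r] is positive at [a] and [b], so [r] changes sign there too. *)
Lemma one_add_wsos_neq a b p s r : p.[a] * p.[b] < 0 -> weighted_sos s ->
  1 + s <> p * r.
Proof.
have [n] := ubnP (size p); elim: n p s r => // n IHn p s r le_n ab0 sP e.
have p0 : p != 0 by apply: contraTneq ab0 => ->; rewrite !horner0 mul0r ltxx.
have [s' [t [s'P es ss']]] := wsos_mod p0 sP.
have {}e : 1 + s' = p * (r - t) by rewrite mulrBr -e es; ring.
have pos x : 0 < p.[x] * (r - t).[x].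
  by rewrite -hornerM -e hornerD hornerC ltr_wpDr // wsos_horner_ge0.
have rt0 : r - t != 0.
  by apply: contraTneq (pos a) => ->; rewrite horner0 mulr0 ltxx.
have sp2 : (1 < size p)%N.
  rewrite ltnNge; apply: contraL ab0 => /size1_polyC->.
  by rewrite !hornerC -leNgt -expr2 sqr_ge0.
apply: (IHn (r - t) s' p) => //; last by rewrite mulrC.
  have : (size (p * (r - t))%R <= (size p).-1.*2.-1)%N.
    rewrite -e; apply: leq_trans (size_polyD _ _) _; rewrite geq_max ss' andbT.
    by rewrite size_poly1; move: sp2; move: (size p) => u; lia.
  rewrite size_mul //; move: le_n sp2.
  by move: (size p) (size (r - t)%R) => u v; lia.
by have := mulr_gt0 (pos a) (pos b); rewrite mulrACA nmulr_rgt0.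
Qed.

(** In K[X], [P0] is the cone generated by the nonnegative constants and the ideal of [p]. By
    [one_add_wsos_neq] it does not contain -1, so (with g = 1) it extends to a prime cone, whose
    support contains [p]; the image of X is the root. *)
Theorem root_extension p a b : p.[a] < 0 < p.[b] ->
  exists (F : realFieldType) (j : {rmorphism K -> F}) (z : F),
    (forall x, 0 <= x -> 0 <= j x) /\ root (map_poly j p) z.
Proof.
move=> /andP[pa pb]; pose P0 q := exists s r, weighted_sos s /\ q = s + p * r.
have sqrP q : weighted_sos (q ^+ 2).
  rewrite -[_ ^+ 2]addr0 -[_ ^+ 2]scale1r.
  by apply: wsos_add wsos0; apply: ler01.
have P0cone : cone P0.
  split=> [_ _ [s [r [sP ->]]] [s' [r' [sP' ->]]] |
           _ _ [s [r [sP ->]]] [s' [r' [sP' ->]]] | q].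
  - by exists (s + s'), (r + r'); split; [exact: wsosD|ring].
  - exists (s * s'), (s * r' + r * s' + r * p * r').
    by split; [exact: wsosM|ring].
  by exists (q ^+ 2), 0; split; rewrite // mulr0 addr0.
have [||P [P0P Pprime _]] := @prime_cone_extension _ 1 P0 => //.
  move=> k [s [r [sP]]]; rewrite expr1n => e.
  apply: (@one_add_wsos_neq a b p s (- r)) => //; first by rewrite nmulr_rlt0.
  by rewrite mulrN -[s](addrK (p * r)) -e; ring.
have [F [h hP]] := prime_cone_field Pprime.
exists F, (h \o polyC), (h 'X); split=> [x x0|].
  apply/hP/P0P; exists x%:P, 0; rewrite mulr0 addr0; split=> //.
  by rewrite -[_%:P]addr0 -[_%:P]mulr1 mul_polyC -(expr1n _ 2);
    apply: wsos_add wsos0.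
have hX q : (map_poly (h \o polyC) q).[h 'X] = h q.
  elim/poly_ind: q => [|q c IHq]; first by rewrite !rmorph0 horner0.
  by rewrite !rmorphD !rmorphM /= map_polyX map_polyC hornerMXaddC IHq.
rewrite rootE hX eq_le -oppr_ge0 -rmorphN; apply/andP; split; apply/hP/P0P.
  by exists 0, (-1); rewrite mulrN1 add0r; split=> //; apply: wsos0.
by exists 0, 1; rewrite mulr1 add0r; split=> //; apply: wsos0.
Qed.

End RootExtension.

(** * Real closed extensions *)

(* A root outside [a, b] can be divided out: the other factor still changes
   sign between a and b. *)
Lemma real_closed_of_roots (F : realFieldType) :
  (forall (p : {poly F}) a b, p.[a] < 0 < p.[b] -> exists x, root p x) ->
  Num.real_closed_axiom F.
Proof.
move=> roots p a b ab; have [n] := ubnP (size p).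
elim: n p => // n IHn p le_n /andP[]; rewrite le_eqVlt => /orP[pa _|pa].
  by exists a; rewrite ?lexx ?ab.
rewrite le_eqVlt => /orP[pb|pb].
  by exists b; rewrite ?lexx ?ab // rootE eq_sym.
have [z pz] := roots p a b (introT andP (conj pa pb)).
have [azb|] := boolP (a <= z <= b); first by exists z.
have p0 : p != 0 by apply: contraTneq pa => ->; rewrite horner0 ltxx.
have /factor_theorem[q e] := pz.
have q0 : q != 0 by apply: contraNneq p0 => q0; rewrite e q0 mul0r.
have le_q : (size q < n)%N.
  by move: le_n; rewrite e size_mul ?polyXsubC_eq0 // size_XsubC addn2.
rewrite negb_and -!ltNge => /orP[zlt|zlt].
  have [||x xab qx] := IHn q => //; last by exists x; rewrite // e rootM qx.
  move: pa pb; rewrite e !hornerM !hornerXsubC.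
  by rewrite pmulr_llt0 ?pmulr_lgt0 ?subr_gt0 // ?(lt_le_trans zlt) // =>
    /ltW-> /ltW->.
have [||x xab qx] := IHn (- q); rewrite ?size_polyN //.
  move: pa pb; rewrite e !hornerM !hornerXsubC !hornerN !oppr_cp0.
  rewrite nmulr_llt0 ?nmulr_lgt0 ?subr_lt0 // ?(le_lt_trans ab) //.
  by move=> /ltW-> /ltW->.
by exists x; rewrite // e rootM -rootN qx.
Qed.

(** * Finite models of terms with named roots *)

Section TermModel.
Variable K : realFieldType.

(* [Root l a b] names a root of the polynomial with coefficient list [l], which
   has to exist only if this polynomial is negative at [a] and positive at
   [b]. *)
Inductive term : Type :=
| Cst of K
| Add of term & term
| Mul of term & term
| Opp of term
| Inv of term
| Root of seq term & term & term.

HB.instance Definition _ := boolp.gen_eqMixin term.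
HB.instance Definition _ := boolp.gen_choiceMixin term.

(** Nesting depth of [Root]: the field operations do not count, as they never leave the field
    already built. *)
Fixpoint rank (t : term) : nat :=
  match t with
  | Cst _ => 0
  | Add u v | Mul u v => maxn (rank u) (rank v)
  | Opp u | Inv u => rank u
  | Root l a b =>
      (maxn (foldr (fun u n => maxn (rank u) n) 0 l)
            (maxn (rank a) (rank b))).+1
  end.

Section Eval.
Variables (F : realFieldType) (iota : K -> F) (rho : term -> F).

Fixpoint eval (t : term) : F :=
  match t with
  | Cst c => iota c
  | Add u v => eval u + eval v
  | Mul u v => eval u * eval v
  | Opp u => - eval u
  | Inv u => (eval u)^-1
  | Root _ _ _ => rho t
  end.

Definition eval_poly (l : seq term) : {poly F} := Poly (map eval l).

Definition realizes (t : term) : Prop :=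
  if t is Root l a b then
    (eval_poly l).[eval a] < 0 < (eval_poly l).[eval b] ->
    root (eval_poly l) (eval t)
  else True.

End Eval.

(** Only the root names listed in [S] have to denote actual roots, which finitely many adjunctions
    achieve. *)
Record model (S : seq term) : Type := Model {
  model_field : realFieldType;
  model_cst : {rmorphism K -> model_field};
  model_root : term -> model_field;
  model_cst_ge0 : forall x, 0 <= x -> 0 <= model_cst x;
  model_realizes : forall t, t \in S -> realizes model_cst model_root t
}.

Lemma eval_agree (F F' : realFieldType) (iota : K -> F) rho
    (j : {rmorphism F -> F'})
    rho' n : (forall t, (rank t < n)%N -> rho' t = j (rho t)) ->
  forall t, (rank t < n)%N -> eval (j \o iota) rho' t = j (eval iota rho t).
Proof.
move=> agree; elim=> [c|u IHu v IHv|u IHu v IHv|u IHu|u IHu|l a _ b _] //=.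
- by rewrite gtn_max => /andP[/IHu-> /IHv->]; rewrite rmorphD.
- by rewrite gtn_max => /andP[/IHu-> /IHv->]; rewrite rmorphM.
- by move=> /IHu->; rewrite rmorphN.
- by move=> /IHu->; rewrite fmorphV.
exact: (agree (Root l a b)).
Qed.

Lemma rank_mem l t : t \in l ->
  (rank t <= foldr (fun u n => maxn (rank u) n) 0 l)%N.
Proof.
elim: l => //= u l IHl; rewrite inE leq_max => /orP[/eqP->|/IHl->].
  by rewrite leqnn.
by rewrite orbT.
Qed.

(** The parts of a root name have smaller rank, so their values are transported by [j]; as an
    order-preserving field morphism is strictly increasing, the sign change can be tested in [F]. *)
Lemma realizes_agree (F F' : realFieldType) (iota : K -> F) rho
    (j : {rmorphism F -> F'}) rho' l a b :
    (forall x, 0 <= x -> 0 <= j x) ->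
    (forall t, (rank t < rank (Root l a b))%N -> rho' t = j (rho t)) ->
  let p := eval_poly iota rho l in
  (p.[eval iota rho a] < 0 < p.[eval iota rho b] ->
      root (map_poly j p) (rho' (Root l a b))) ->
  realizes (j \o iota) rho' (Root l a b).
Proof.
move=> j0 agree p pr.
have agr := eval_agree iota agree.
have le_l t : t \in l -> (rank t < rank (Root l a b))%N.
  by move=> /rank_mem tl; rewrite /= ltnS leq_max tl.
have le_a : (rank a < rank (Root l a b))%N by rewrite /= ltnS !leq_max leqnn
  orbT.
have le_b : (rank b < rank (Root l a b))%N by rewrite /= ltnS !leq_max leqnn
  !orbT.
have ep : eval_poly (j \o iota) rho' l = map_poly j p.
  rewrite /p /eval_poly map_Poly -map_comp; congr Poly.
  by apply/eq_in_map => t /le_l/agr.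
have jlt x y : (j x < j y) = (x < y).
  have jle u v : u <= v -> j u <= j v.
    by rewrite -subr_ge0 => /j0; rewrite rmorphB subr_ge0.
  have [xy|yx] := ltrP x y; last by apply/negbTE; rewrite -leNgt jle.
  by rewrite lt_neqAle jle ?ltW // fmorph_eq lt_eqF.
rewrite /realizes ep (agr a le_a) (agr b le_b) !horner_map -(rmorph0 j) !jlt.
exact: pr.
Qed.

(* Roots are adjoined by increasing rank, so that a new root occurs in no term
   whose value has already been fixed. *)
Lemma model_sorted S : sorted (fun t u => rank u <= rank t)%N S ->
  inhabited (model S).
Proof.
elim: S => [_|t S IHS].
  by exists; exists K (GRing.RMorphism.clone _ _ idfun _) (fun=> 0).
move=> tS; have [[F iota rho iota0 rhoP]] := IHS (path_sorted tS).
have rank_t u : u \in S -> (rank u <= rank t)%N.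
  by move=> uS; apply: (allP (order_path_min _ tS)) => // x y z xy /leq_trans;
    apply.
case: t tS rank_t => [c|u v|u v|u|u|l a b] _ rank_t.
1-5: by exists; exists F iota rho => // t; rewrite inE => /orP[/eqP->|/rhoP].
set t := Root l a b; pose p := eval_poly iota rho l.
(* Without the required sign change no root is asked for: the field is kept, and 0 is a dummy
   value. *)
have [F' [j [z [j0 pz]]]] :
    exists (F' : realFieldType) (j : {rmorphism F -> F'}) (z : F'),
    (forall x, 0 <= x -> 0 <= j x) /\
    (p.[eval iota rho a] < 0 < p.[eval iota rho b] -> root (map_poly j p) z).
  have [/root_extension[F' [j [z [j0 pz]]]]|_] :=
    boolP (p.[eval iota rho a] < 0 < p.[eval iota rho b]).
    by exists F', j, z.
  by exists F, (GRing.RMorphism.clone _ _ idfun _), 0.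
pose rho' u := if u == t then z else j (rho u).
have agree u : (rank u < rank t)%N -> rho' u = j (rho u).
  by rewrite /rho'; case: eqP => // ->; rewrite ltnn.
exists; exists F' (j \o iota) rho' => [x x0|u]; first exact/j0/iota0.
rewrite inE => utS.
have rank_u : (rank u <= rank t)%N by case/orP: utS => [/eqP->|/rank_t].
case: u utS rank_u => // l' a' b' uS rank_u.
apply: (@realizes_agree _ _ iota rho) => // [v vu|].
  by apply: agree; apply: leq_trans rank_u.
rewrite /rho'; case: eqP => [[-> -> ->]//|ut] lt.
have /rhoP : Root l' a' b' \in S by case/orP: uS => // /eqP.
by move=> /(_ lt) /=; rewrite !rootE horner_map => /eqP->; rewrite rmorph0.
Qed.

Lemma model_inhabited S : inhabited (model S).
Proof.
have [|[F iota rho iota0 rhoP]] :=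
  @model_sorted (sort (fun t u => rank u <= rank t)%N S).
  by apply: sort_sorted => t u; apply: leq_total.
by exists; exists F iota rho => // t tS; apply: rhoP; rewrite mem_sort.
Qed.

Definition models S : model S :=
  projT1 (boolp.cid (let: inhabits m := model_inhabited S in ex_intro _ m I)).

End TermModel.

(** * The limit of the models along an ultrafilter *)

Section Limit.
Variable K : realFieldType.
Notation term := (term K).
Notation mfield S := (model_field (models (S : seq term))).

Definition term_value S (t : term) : mfield S :=
  eval (model_cst (models S)) (model_root (models S)) t.

(** The sets containing all finite lists above some given list form a proper filter. An ultrafilter
    refining it makes every single root name valid in almost all models. *)
Lemma ultrafilter_exists : exists U : (seq term -> Prop) -> Prop,
  [/\ forall S : seq term, U (fun S' : seq term => {subset S <= S'}),
      forall Q Q', U Q -> (forall S, Q S -> Q' S) -> U Q',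
      forall Q Q', U Q -> U Q' -> U (fun S => Q S /\ Q' S),
      ~ U (fun=> False) & forall Q, U Q \/ U (fun S => ~ Q S)].
Proof.
pose B (Q : seq term -> Prop) :=
  exists S : seq term, forall S' : seq term, {subset S <= S'} -> Q S'.
have FB : filter.ProperFilter B.
  split; first by case=> S /(_ S); apply.
  split=> [|Q Q' [S SQ] [S' SQ']|Q Q' QQ' [S SQ]]; first by exists [::].
    exists (S ++ S') => S2 sub; split.
      by apply: SQ => t tS; apply: sub; rewrite mem_cat tS.
    by apply: SQ' => t tS; apply: sub; rewrite mem_cat tS orbT.
  by exists S => S' sub; apply/QQ'/SQ.
have [U [ultraU BU]] := filter.ultraFilterLemma FB.
exists U; split.
- by move=> S; apply: BU; exists S.
- by move=> Q Q' UQ QQ'; apply: filter.filterS UQ.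
- by move=> Q Q' UQ UQ'; apply: filter.filterI.
- exact: filter.filter_not_empty.
by move=> Q; apply: filter.in_ultra_setVsetC.
Qed.

Definition ultra := projT1 (boolp.cid ultrafilter_exists).

Let ultraP := projT2 (boolp.cid ultrafilter_exists).

Lemma ultra_finer (S : seq term) :
  ultra (fun S' : seq term => {subset S <= S'}).
Proof. by case: ultraP => h _ _ _ _; apply: h. Qed.
Lemma ultra_mono (Q Q' : seq term -> Prop) :
  ultra Q -> (forall S, Q S -> Q' S) -> ultra Q'.
Proof. by case: ultraP => _ h _ _ _; apply: h. Qed.
Lemma ultra_and (Q Q' : seq term -> Prop) :
  ultra Q -> ultra Q' -> ultra (fun S => Q S /\ Q' S).
Proof. by case: ultraP => _ _ h _ _; apply: h. Qed.
Lemma ultra_false : ~ ultra (fun=> False).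
Proof. by case: ultraP. Qed.
Lemma ultra_em (Q : seq term -> Prop) : ultra Q \/ ultra (fun S => ~ Q S).
Proof. by case: ultraP => _ _ _ _; apply. Qed.
Lemma ultra_true (Q : seq term -> Prop) : (forall S, Q S) -> ultra Q.
Proof. by move=> QP; apply: ultra_mono (ultra_finer [::]) _. Qed.
Lemma ultra_and_mono (Q Q' Q2 : seq term -> Prop) :
  ultra Q -> ultra Q' -> (forall S, Q S -> Q' S -> Q2 S) -> ultra Q2.
Proof.
by move=> UQ UQ' h; apply: ultra_mono (ultra_and UQ UQ') _ => S [];
  apply: h.
Qed.

Definition eqterm (t u : term) : bool :=
  boolp.asbool (ultra (fun S => term_value S t = term_value S u)).

Lemma eqtermP t u :
  reflect (ultra (fun S => term_value S t = term_value S u)) (eqterm t u).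
Proof. exact: boolp.asboolP. Qed.

Lemma eqterm_refl : reflexive eqterm.
Proof. by move=> t; apply/eqtermP/ultra_true. Qed.
Lemma eqterm_sym : ssrbool.symmetric eqterm.
Proof. by move=> t u; apply/eqtermP/eqtermP => /ultra_mono; apply. Qed.
Lemma eqterm_trans : transitive eqterm.
Proof.
move=> u t v /eqtermP tu /eqtermP uv; apply/eqtermP.
by apply: ultra_and_mono tu uv _ => S ->.
Qed.

Canonical eqterm_equiv := EquivRel eqterm eqterm_refl eqterm_sym eqterm_trans.

(** The subfield of the ultraproduct formed by the families of values of terms; thanks to [Root] it
    is already real closed. *)
Definition limit : Type := {eq_quot eqterm}%qT.
HB.instance Definition _ := Choice.on limit.

Definition cls (t : term) : limit := (\pi_limit t)%qT.

Lemma clsP t u :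
  cls t = cls u <-> ultra (fun S => term_value S t = term_value S u).
Proof.
split=> [/eqmodP/eqtermP//|h]; apply/eqmodP; exact/eqtermP.
Qed.

Lemma clsE t u : (forall S, term_value S t = term_value S u) -> cls t = cls u.
Proof. by move=> h; apply/clsP/ultra_true. Qed.

Lemma cls_repr (x : limit) : cls (repr x) = x.
Proof. exact: reprK. Qed.

Lemma cls_ind (Q : limit -> Prop) : (forall t, Q (cls t)) -> forall x, Q x.
Proof. by move=> h x; rewrite -(cls_repr x). Qed.

Lemma repr_cls t :
  ultra (fun S => term_value S (repr (cls t)) = term_value S t).
Proof. by apply/clsP; rewrite cls_repr. Qed.

Definition limit_add (x y : limit) := cls (Add (repr x) (repr y)).
Definition limit_mul (x y : limit) := cls (Mul (repr x) (repr y)).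
Definition limit_opp (x : limit) := cls (Opp (repr x)).
Definition limit_inv (x : limit) := cls (Inv (repr x)).

Lemma limit_addE t u : limit_add (cls t) (cls u) = cls (Add t u).
Proof.
by apply/clsP; apply: ultra_and_mono (repr_cls t) (repr_cls u) _ => S;
  rewrite /term_value /= => -> ->.
Qed.
Lemma limit_mulE t u : limit_mul (cls t) (cls u) = cls (Mul t u).
Proof.
by apply/clsP; apply: ultra_and_mono (repr_cls t) (repr_cls u) _ => S;
  rewrite /term_value /= => -> ->.
Qed.
Lemma limit_oppE t : limit_opp (cls t) = cls (Opp t).
Proof.
by apply/clsP; apply: ultra_mono (repr_cls t) _ => S;
  rewrite /term_value /= => ->.
Qed.
Lemma limit_invE t : limit_inv (cls t) = cls (Inv t).
Proof.
by apply/clsP; apply: ultra_mono (repr_cls t) _ => S;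
  rewrite /term_value /= => ->.
Qed.

Let laddA : associative limit_add.
Proof.
elim/cls_ind=> t; elim/cls_ind=> u; elim/cls_ind=> v; rewrite !limit_addE.
by apply: clsE => S; apply: addrA.
Qed.
Let laddC : commutative limit_add.
Proof.
elim/cls_ind=> t; elim/cls_ind=> u; rewrite !limit_addE.
by apply: clsE => S; apply: addrC.
Qed.
Let ladd0 : left_id (cls (Cst 0)) limit_add.
Proof.
elim/cls_ind=> t; rewrite limit_addE; apply: clsE => S.
by rewrite /term_value /= rmorph0 add0r.
Qed.
Let laddN : left_inverse (cls (Cst 0)) limit_opp limit_add.
Proof.
elim/cls_ind=> t; rewrite limit_oppE limit_addE; apply: clsE => S.
by rewrite /term_value /= rmorph0 addNr.
Qed.
HB.instance Definition _ := GRing.isZmodule.Build limit laddA laddC ladd0 laddN.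

Let lmulA : associative limit_mul.
Proof.
elim/cls_ind=> t; elim/cls_ind=> u; elim/cls_ind=> v; rewrite !limit_mulE.
by apply: clsE => S; apply: mulrA.
Qed.
Let lmulC : commutative limit_mul.
Proof.
elim/cls_ind=> t; elim/cls_ind=> u; rewrite !limit_mulE.
by apply: clsE => S; apply: mulrC.
Qed.
Let lmul1 : left_id (cls (Cst 1)) limit_mul.
Proof.
elim/cls_ind=> t; rewrite limit_mulE; apply: clsE => S.
by rewrite /term_value /= rmorph1 mul1r.
Qed.
Let lmulD : left_distributive limit_mul limit_add.
Proof.
elim/cls_ind=> t; elim/cls_ind=> u; elim/cls_ind=> v.
by rewrite !(limit_addE, limit_mulE); apply: clsE => S; apply: mulrDl.
Qed.
Let lone_neq0 : cls (Cst 1) != cls (Cst 0).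
Proof.
apply/eqP => /clsP h; apply: ultra_false; apply: ultra_mono h _ => S.
by rewrite /term_value /= rmorph1 rmorph0 => /eqP; rewrite oner_eq0.
Qed.
HB.instance Definition _ :=
  GRing.Zmodule_isComNzRing.Build limit lmulA lmulC lmul1 lmulD lone_neq0.

Let lmulV x : x != 0 -> limit_inv x * x = 1.
Proof.
elim/cls_ind: x => t t0; rewrite limit_invE [LHS]limit_mulE; apply/clsP.
have [h|] := ultra_em (fun S => term_value S t = 0).
  case/eqP: t0; apply/clsP; apply: ultra_mono h _ => S ->.
  by rewrite /term_value /= rmorph0.
by move=> h; apply: ultra_mono h _ => S /eqP h;
  rewrite /term_value /= rmorph1 mulVf.
Qed.
Let linv0 : limit_inv 0 = 0.
Proof.
by rewrite [LHS]limit_invE; apply: clsE => S;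
  rewrite /term_value /= rmorph0 invr0.
Qed.
HB.instance Definition _ := GRing.ComNzRing_isField.Build limit lmulV linv0.

Definition limit_nonneg (x : limit) : bool :=
  boolp.asbool (ultra (fun S => 0 <= term_value S (repr x))).

Lemma limit_nonnegP t : limit_nonneg (cls t) <->
  ultra (fun S => 0 <= term_value S t).
Proof.
split=> [/boolp.asboolP h|h].
  by apply: ultra_and_mono h (repr_cls t) _ => S + <-.
by apply/boolp.asboolP; apply: ultra_and_mono h (repr_cls t) _ => S + ->.
Qed.

Let lnonnegD x y : limit_nonneg x -> limit_nonneg y -> limit_nonneg (x + y).
Proof.
elim/cls_ind: x => t; elim/cls_ind: y => u /limit_nonnegP t0 /limit_nonnegP u0.
by rewrite [_ + _]limit_addE; apply/limit_nonnegP/(ultra_and_mono t0 u0) => S;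
  apply: addr_ge0.
Qed.
Let lnonnegM x y : limit_nonneg x -> limit_nonneg y -> limit_nonneg (x * y).
Proof.
elim/cls_ind: x => t; elim/cls_ind: y => u /limit_nonnegP t0 /limit_nonnegP u0.
by rewrite [_ * _]limit_mulE; apply/limit_nonnegP/(ultra_and_mono t0 u0) => S;
  apply: mulr_ge0.
Qed.
Let lnonneg_anti x : limit_nonneg x -> limit_nonneg (- x) -> x = 0.
Proof.
elim/cls_ind: x => t /limit_nonnegP t0;
  rewrite [- _]limit_oppE => /limit_nonnegP tN.
apply/clsP/(ultra_and_mono t0 tN) => S;
  rewrite /term_value /= rmorph0 oppr_ge0 => h1 h2.
by apply/eqP; rewrite eq_le h1 h2.
Qed.
Let lnonneg_total x : limit_nonneg x || limit_nonneg (- x).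
Proof.
elim/cls_ind: x => t; rewrite [- _]limit_oppE.
have [h|h] := ultra_em (fun S => 0 <= term_value S t).
  by apply/orP; left; apply/limit_nonnegP.
apply/orP; right; apply/limit_nonnegP/(ultra_mono h) => S.
by move=> /negP; rewrite -ltNge /term_value /= oppr_ge0 => /ltW.
Qed.

Definition limit_field : realFieldType :=
  ordered_field lnonnegD lnonnegM lnonneg_anti lnonneg_total.

Lemma cls_ge0 t : (0 <= cls t :> limit_field) <->
  ultra (fun S => 0 <= term_value S t).
Proof. by rewrite ordered_field_ge0; apply: limit_nonnegP. Qed.

Lemma cls_gt0 t : (0 < cls t :> limit_field) <->
  ultra (fun S => 0 < term_value S t).
Proof.
rewrite ltNge -oppr_ge0 [- _]limit_oppE; split=> [/negP h|h].
  have [//|hN] := ultra_em (fun S => 0 < term_value S t); case: h;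
    apply/cls_ge0.
  by apply: ultra_mono hN _ => S /negP; rewrite -leNgt -oppr_ge0.
apply/negP => /cls_ge0 hN; apply: ultra_false;
  apply: ultra_and_mono h hN _ => S.
by rewrite /term_value /= oppr_ge0 ltNge => /negP.
Qed.

End Limit.

(** * The limit is real closed *)

Section RealClosedExtension.
Variable K : realFieldType.
Notation E := (limit_field K).

Fixpoint horner_term (l : seq (term K)) (x : term K) : term K :=
  if l is c :: l' then Add (Mul (horner_term l' x) x) c else Cst 0.

Lemma value_horner_term S l x : term_value S (horner_term l x) =
  (eval_poly (model_cst (models S)) (model_root (models S)) l).[term_value S x].
Proof.
rewrite horner_Poly; elim: l => [|c l IHl];
  first by rewrite /term_value /= rmorph0.
by rewrite /term_value /= in IHl *; rewrite IHl.
Qed.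

Lemma cls_horner_term (l : seq (term K)) x :
  cls (horner_term l x) = horner_rec (map (@cls K) l : seq E) (cls x).
Proof.
elim: l => [//|c l IHl] /=; rewrite -IHl.
by rewrite -[_ + _]/(limit_add (limit_mul _ _) _) limit_mulE limit_addE.
Qed.

(** The root is the class of the name [t] built from representatives of the coefficients and of a
    and b: in almost all models the sign change holds and [t] is listed, hence [t] denotes a root
    there. *)
Lemma limit_roots (p : {poly E}) a b : p.[a] < 0 < p.[b] -> exists x, root p x.
Proof.
pose l : seq (term K) := map repr p.
have pE t : p.[cls t] = cls (horner_term l t).
  rewrite cls_horner_term -map_comp map_id_in // => x _; exact: cls_repr.
rewrite -(cls_repr a) -(cls_repr b) !pE -oppr_gt0 [- _]limit_oppE.
move=> /andP[/cls_gt0 pa /cls_gt0 pb].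
set t := Root l (repr a) (repr b).
exists (cls t); rewrite rootE pE; apply/eqP/clsP.
apply: ultra_and_mono (ultra_and pa pb) (ultra_finer [:: t]) _ =>
  S [pa' pb'] tS.
have : t \in S by apply: tS; rewrite inE.
move=> /(model_realizes (models S)) /=.
rewrite -[eval _ _ (repr a)]/(term_value S (repr a)) -[eval _ _ (repr
  b)]/(term_value S (repr b)).
rewrite -!value_horner_term.
have -> : term_value S (horner_term l (repr a)) < 0.
  by rewrite -oppr_gt0.
rewrite pb' => /(_ isT); rewrite rootE => /eqP.
by rewrite value_horner_term => ->; rewrite /term_value /= rmorph0.
Qed.

Let limit_closed : Num.real_closed_axiom E := real_closed_of_roots limit_roots.

Definition limit_rcf : rcfType :=
  HB.pack_for rcfType (limit K : Type) (Num.RealField.on E)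
    (Num.RealField_isClosed.Build E limit_closed).

Definition limit_cst (c : K) : E := cls (Cst c).

Lemma limit_cst_additive : zmod_morphism limit_cst.
Proof.
move=> c d; rewrite /limit_cst -[_ - _ in RHS]/(limit_add _ (limit_opp _))
  limit_oppE limit_addE.
by apply: clsE => S; rewrite /term_value /= rmorphB.
Qed.
Lemma limit_cst_multiplicative : monoid_morphism limit_cst.
Proof.
split=> // c d; rewrite /limit_cst -[_ * _ in RHS]/(limit_mul _ _) limit_mulE.
by apply: clsE => S; rewrite /term_value /= rmorphM.
Qed.
HB.instance Definition _ :=
  GRing.isZmodMorphism.Build K E limit_cst limit_cst_additive.
HB.instance Definition _ :=
  GRing.isMonoidMorphism.Build K E limit_cst limit_cst_multiplicative.

Theorem real_closed_extension : exists (F : rcfType) (h : {rmorphism K -> F}),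
  forall x, 0 <= x -> 0 <= h x.
Proof.
exists limit_rcf, limit_cst => x x0; apply/cls_ge0/ultra_true => S.
exact: model_cst_ge0.
Qed.

End RealClosedExtension.

(** * Transfer between real closed fields *)

Section CauchyIndex.
Import Pdiv.Idomain Pdiv.Ring.
Variable F : rcfType.
Implicit Types p q r : {poly F}.

(** Reciprocity of Cauchy indices: [cindexR_rec] gives it for a negated pseudo-remainder, whose
    jumps are those of p / q up to the sign of the scaling factor. *)
Lemma cindexR_inv p q : cindexR q p = crossR (p * q) - cindexR p q.
Proof.
rewrite cindexR_rec; congr (_ + _); rewrite /cindexR -sumrN.
apply: eq_bigr => x _.
by rewrite jump_mulCp [in RHS]jump_mod sgzN sgzX mulNr.
Qed.

Lemma cindexR_modp p q : cindexR p q = cindexR (p %% q) q.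
Proof.
apply: eq_bigr => x _; have [->|q0] := eqVneq q 0; first by rewrite !jumppc.
rewrite modpE unitfE lead_coef_eq0 q0 jump_mulCp [LHS]jump_mod.
by rewrite -sgzX; congr (_ * _); rewrite /sgz invr_eq0 invr_lt0.
Qed.

Lemma cindexR_pdiv c p q d r : c != 0 -> c *: p = d * q + r ->
  cindexR p q = sgz c * cindexR r q.
Proof.
move=> c0 e; have -> : cindexR r q = sgz c * cindexR p q.
  transitivity (cindexR (c *: p) q).
    by rewrite e [RHS]cindexR_modp modpD modp_mull add0r -cindexR_modp.
  by rewrite /cindexR mulr_sumr; apply: eq_bigr => x _; rewrite jump_mulCp.
by rewrite mulrA mulz_sg c0 mul1r.
Qed.

End CauchyIndex.

Lemma variation_sgz (F : rcfType) (x y : F) :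
  variation x y = sgz y * (sgz x * sgz y < 0)%R.
Proof. by rewrite /variation -sgzM sgz_lt0. Qed.

(** * Specialising coefficients in two real closed fields *)

Section SignTransfer.
Variables (B : idomainType) (F1 F2 : rcfType).
Variables (e1 : {rmorphism B -> F1}) (e2 : {rmorphism B -> F2}).

Definition same_signs (G : seq B) := {in G, forall b, sgz (e1 b) = sgz (e2 b)}.

Lemma same_signs_cat G1 G2 :
  same_signs (G1 ++ G2) <-> same_signs G1 /\ same_signs G2.
Proof.
split=> [s|[s1 s2] b]; last by rewrite mem_cat => /orP[/s1|/s2].
by split=> b bG; apply: s; rewrite mem_cat bG ?orbT.
Qed.

Lemma same_signs_coef (q : {poly B}) i : same_signs q ->
  sgz (map_poly e1 q)`_i = sgz (map_poly e2 q)`_i.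
Proof.
move=> s; rewrite !coef_map /=.
have [iq|iq] := ltnP i (size q); first by apply: s; exact: mem_nth.
by rewrite nth_default // !rmorph0 !sgz0.
Qed.

Lemma same_signs_size (q : {poly B}) : same_signs q ->
  size (map_poly e1 q) = size (map_poly e2 q).
Proof.
move=> s; apply/eqP; rewrite eqn_leq; apply/andP; split.

  apply/leq_sizeP => i iq; apply/eqP.
  by rewrite -sgz_eq0 (same_signs_coef _ s) sgz_eq0 nth_default.
apply/leq_sizeP => i iq; apply/eqP.
by rewrite -sgz_eq0 -(same_signs_coef _ s) sgz_eq0 nth_default.
Qed.

Lemma same_signs_lead_coef (q : {poly B}) : same_signs q ->
  sgz (lead_coef (map_poly e1 q)) = sgz (lead_coef (map_poly e2 q)).
Proof.
by move=> s; rewrite !lead_coefE (same_signs_size s); apply: same_signs_coef.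
Qed.

Lemma same_signs_crossR (p q : {poly B}) : same_signs p -> same_signs q ->
  crossR (map_poly e1 p * map_poly e1 q) =
  crossR (map_poly e2 p * map_poly e2 q).
Proof.
move=> sp sq; rewrite /crossR !variation_sgz.
have -> : sgz (sgp_pinfty (map_poly e1 p * map_poly e1 q)) =
          sgz (sgp_pinfty (map_poly e2 p * map_poly e2 q)).
  rewrite /sgp_pinfty !sgz_sgr !lead_coefM !sgzM.
  by rewrite (same_signs_lead_coef sp) (same_signs_lead_coef sq).
suff -> : sgz (sgp_minfty (map_poly e1 p * map_poly e1 q)) =
          sgz (sgp_minfty (map_poly e2 p * map_poly e2 q)) by [].
rewrite /sgp_minfty !sgz_sgr !lead_coefM.
rewrite !sgzM !sgzX !sgzN !sgz1 (same_signs_lead_coef sp).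
rewrite (same_signs_lead_coef sq); congr (_ ^+ _ * _).
have [p0|p0] := eqVneq (map_poly e1 p) 0.
  have := same_signs_size sp; rewrite p0 size_poly0 => /esym/eqP.
  by rewrite size_poly_eq0 => /eqP->; rewrite !mul0r !size_poly0.
have [q0|q0] := eqVneq (map_poly e1 q) 0.
  have := same_signs_size sq; rewrite q0 size_poly0 => /esym/eqP.
  by rewrite size_poly_eq0 => /eqP->; rewrite !mulr0 !size_poly0.
rewrite !size_mul // -?size_poly_eq0 -?(same_signs_size sp)
  -?(same_signs_size sq) ?size_poly_eq0 //.
Qed.

End SignTransfer.
Arguments same_signs {B F1 F2} e1 e2 G.

(** * Sign conditions on polynomials in one variable *)

Section Uniform.
Import Pdiv.Idomain Pdiv.Ring.
Variable (B : idomainType).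
Implicit Types (p q r : {poly B}) (G : seq B).

(* Agrees with q wherever the leading coefficient of q vanishes. *)
Definition behead_poly q := take_poly (size q).-1 q.

Lemma behead_polyE (F : rcfType) (e : {rmorphism B -> F}) q :
  e (lead_coef q) = 0 -> map_poly e q = map_poly e (behead_poly q).
Proof.
move=> e0; apply/polyP => i; rewrite !coef_map coef_take_poly /=.
case: ltngtP => // [iq|->]; last by rewrite -lead_coefE e0 rmorph0.
by rewrite nth_default ?rmorph0 //; case: (size q) iq.
Qed.

Lemma size_behead_poly q : (size (behead_poly q) <= (size q).-1)%N.
Proof. exact: size_take_poly. Qed.

(** A semantic form of quantifier elimination: instead of a formula, a finite list of elements of
    [B] whose signs fix the value, uniformly over all real closed fields. *)
Definition sign_determined (T : Type)
    (phi : forall F : rcfType, {rmorphism B -> F} -> T) : Prop :=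
  exists G, forall (F1 F2 : rcfType) (e1 : {rmorphism B -> F1})
    (e2 : {rmorphism B -> F2}), same_signs e1 e2 G -> phi F1 e1 = phi F2 e2.

(** Euclid's algorithm with case distinctions: if a leading coefficient is mapped to 0 it is
    dropped; otherwise reciprocity and pseudo-division replace the pair by [q] and the
    pseudo-remainder. The list collects those of all branches together with the coefficients of [p]
    and [q], which tell the branches apart. *)
Lemma cindexR_transfer p q : sign_determined
  (fun F e => cindexR (map_poly e q) (map_poly e p)).
Proof.
have [n] := ubnP (size p + size q); elim: n p q => // n IHn p q le_n.
have [->|p0] := eqVneq p 0.
  by exists [::] => F1 F2 e1 e2 _; rewrite !map_polyC /= !cindexRpC.
have [->|q0] := eqVneq q 0.
  by exists [::] => F1 F2 e1 e2 _; rewrite !map_polyC /= !rmorph0 !cindexR0p.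
(* The other case is reduced to this one by reciprocity. *)
wlog le_qp : p q p0 q0 le_n / (size q <= size p)%N => [th|].
  have [/th|/ltnW le_pq] := leqP (size q) (size p); first exact.
  have [||G GP] := th q p q0 p0 _ _; rewrite 1?addnC //.
  exists (G ++ p ++ q) => F1 F2 e1 e2 /same_signs_cat[/GP e].
  move=> /same_signs_cat[sp sq]; rewrite cindexR_inv e [RHS]cindexR_inv.
  by rewrite (same_signs_crossR sp sq).
have sp0 : (0 < size p)%N by rewrite size_poly_gt0.
have sq0 : (0 < size q)%N by rewrite size_poly_gt0.
have [G1 G1P] : sign_determined
  (fun F e => cindexR (map_poly e q) (map_poly e (behead_poly p))).
  apply: IHn; have := size_behead_poly p; move: le_n; rewrite -(prednK sp0) /=.
  by rewrite addSn ltnS => + le; apply: leq_trans; rewrite ltnS leq_add2r.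
have [G2 G2P] : sign_determined
  (fun F e => cindexR (map_poly e (behead_poly q)) (map_poly e p)).
  apply: IHn; have := size_behead_poly q; move: le_n; rewrite -(prednK sq0) /=.
  by rewrite addnS ltnS => + le; apply: leq_trans; rewrite ltnS leq_add2l.
pose r := rmodp p q.
have [G3 G3P] : sign_determined
  (fun F e => cindexR (map_poly e r) (map_poly e q)).
  apply: IHn; apply: leq_trans (_ : size p + size q <= n)%N => //.
  by rewrite -addnS leq_add // /r ltn_rmodp.
exists (G1 ++ G2 ++ G3 ++ p ++ q) => F1 F2 e1 e2.
move=> /same_signs_cat[s1] /same_signs_cat[s2] /same_signs_cat[s3].
move=> /same_signs_cat[sp sq].
have lcs (u : {poly B}) : same_signs e1 e2 u ->
  sgz (e1 (lead_coef u)) = sgz (e2 (lead_coef u)).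
  have [->|u0] := eqVneq u 0; first by rewrite lead_coef0 !rmorph0 !sgz0.
  by apply; apply: mem_nth; rewrite prednK ?size_poly_gt0.
have lcs0 (u : {poly B}) : same_signs e1 e2 u -> e1 (lead_coef u) = 0 ->
  e2 (lead_coef u) = 0.
  by move=> /lcs + e; rewrite e sgz0 => /esym/eqP; rewrite sgz_eq0 => /eqP.
have [pe|pe] := eqVneq (e1 (lead_coef p)) 0.
  rewrite !(behead_polyE pe) !(behead_polyE (lcs0 p sp pe)).
  exact: G1P s1.
have [qe|qe] := eqVneq (e1 (lead_coef q)) 0.
  rewrite !(behead_polyE qe) !(behead_polyE (lcs0 q sq qe)).
  exact: G2P s2.
rewrite cindexR_inv [RHS]cindexR_inv (same_signs_crossR sp sq); congr (_ - _).
have pdiv (F : rcfType) (e : {rmorphism B -> F}) : e (lead_coef q) != 0 ->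
   cindexR (map_poly e p) (map_poly e q) =
     sgz (e (lead_coef q)) ^+ rscalp p q *
     cindexR (map_poly e r) (map_poly e q).
  move=> e0; rewrite -sgzX.
  apply: (@cindexR_pdiv _ _ _ _ (map_poly e (rdivp p q))).
    by rewrite expf_neq0.
  rewrite -rmorphXn -map_polyZ /= Pdiv.ComRing.rdivp_eq.
  by rewrite rmorphD rmorphM.
rewrite !pdiv // ?(lcs q sq) ?(G3P _ _ _ _ s3) //.
by rewrite -sgz_eq0 -(lcs q sq) sgz_eq0.
Qed.

Definition all_pos (F : rcfType) (sq : seq {poly F}) (x : F) :=
  all (fun q : {poly F} => 0 < q.[x]) sq.

(* For a sign s, s + s^2 is 2 if s = 1 and 0 otherwise, so for u = 1 the sum
   counts, up to a power of 2, the roots of p where all of sq is positive. *)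
Lemma tarski_sum_sign_determined p u (sq : seq {poly B}) : sign_determined
  (fun F e => \sum_(x <- rootsR (map_poly e p)) sgz (map_poly e u).[x] *
     \prod_(q <- sq) (sgz (map_poly e q).[x] + sgz (map_poly e q).[x] ^+ 2)).
Proof.
elim: sq u => [|q sq IHsq] u.
  have [G GP] := cindexR_transfer p (p^`() * u).
  exists G => F1 F2 e1 e2 /GP /=.
  rewrite !rmorphM /= -!deriv_map -!changes_mods_cindex -!/(taqR _ _)
    -!taq_taqR.
  rewrite /taq => e.
  under eq_bigr do rewrite big_nil mulr1.
  by rewrite e; apply: eq_bigr => x _; rewrite big_nil mulr1.
have [G1 G1P] := IHsq (u * q); have [G2 G2P] := IHsq (u * (q * q)).
exists (G1 ++ G2) => F1 F2 e1 e2 /same_signs_cat[/G1P {}G1P /G2P {}G2P].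
have split (F : rcfType) (e : {rmorphism B -> F}) :
  \sum_(x <- rootsR (map_poly e p)) sgz (map_poly e u).[x] * \prod_(q <- q ::
    sq)
     (sgz (map_poly e q).[x] + sgz (map_poly e q).[x] ^+ 2) =
  \sum_(x <- rootsR (map_poly e p)) sgz (map_poly e (u * q)).[x] * \prod_(q <-
    sq)
     (sgz (map_poly e q).[x] + sgz (map_poly e q).[x] ^+ 2) +
  \sum_(x <- rootsR (map_poly e p)) sgz (map_poly e (u * (q * q))).[x] *
    \prod_(q <- sq) (sgz (map_poly e q).[x] + sgz (map_poly e q).[x] ^+ 2).
  rewrite -big_split /=; apply: eq_bigr => x _.
  rewrite big_cons !rmorphM /= !hornerM !sgzM -expr2.
  by rewrite -mulrDl -mulrDr mulrA.
by rewrite !split G1P G2P.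
Qed.

(** All terms are nonnegative, so nothing cancels and a nonzero sum has a nonzero term. *)
Lemma tarski_sumP (F : rcfType) (p : {poly F}) (sq : seq {poly F}) : p != 0 ->
  reflect (exists2 x, p.[x] = 0 & all_pos sq x)
    (\sum_(x <- rootsR p)
       \prod_(q <- sq) (sgz q.[x] + sgz q.[x] ^+ 2) != 0).
Proof.
move=> p0; have ge0 (s : int) : s \in [:: -1; 0; 1] -> 0 <= s + s ^+ 2.
  by rewrite !inE => /or3P[] /eqP->.
have sgz_in (y : F) : sgz y \in [:: -1; 0; 1] by case: sgzP.
rewrite psumr_neq0; last first.
  by move=> x _; apply: prodr_ge0 => q _; apply: ge0.
apply: (iffP hasP) => [[x xp /=]|[x px /allP sqx]]; last first.
  exists x; first by rewrite -roots_on_rootsR //= rootE px eqxx.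
  rewrite /= big_seq prodr_gt0 // => q /sqx qx.
  by rewrite (gtr0_sgz qx).
rewrite lt0r prodf_seq_neq0 => /andP[/allP sqx _]; exists x.
  by apply/eqP; move: xp; rewrite -roots_on_rootsR // => /andP[].
apply/allP => q /sqx /=; case: sgzP => //.
Qed.

Lemma root_transfer p (sq : seq {poly B}) : exists G, forall (F1 F2 : rcfType)
    (e1 : {rmorphism B -> F1}) (e2 : {rmorphism B -> F2}),
  same_signs e1 e2 G -> map_poly e1 p != 0 ->
  (exists2 x, (map_poly e1 p).[x] = 0 & all_pos (map (map_poly e1) sq) x) ->
  exists2 x, (map_poly e2 p).[x] = 0 & all_pos (map (map_poly e2) sq) x.
Proof.
have [G GP] := tarski_sum_sign_determined p 1 sq.
exists (G ++ p) => F1 F2 e1 e2 /same_signs_cat[/GP {}GP sp] p0.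
have p0' : map_poly e2 p != 0.
  by rewrite -size_poly_eq0 -(same_signs_size sp) size_poly_eq0.
move=> /(tarski_sumP _ p0) nz; apply/(tarski_sumP _ p0').
move: GP nz; rewrite !rmorph1.
under eq_bigr do rewrite hornerC sgz1 mul1r.
under [X in _ = X]eq_bigr do rewrite hornerC sgz1 mul1r.
under [in X in _ -> is_true X -> _]eq_bigr do rewrite big_map.
by under [in X in _ -> _ -> is_true X]eq_bigr do rewrite big_map; move=> ->.
Qed.

(** An interval on which all of [sq] is positive either reaches an infinity, where leading
    coefficients decide, or lies between two zeros of the product, where Rolle's theorem gives a
    zero of its derivative and [root_transfer] applies. *)
Lemma pos_transfer (sq : seq {poly B}) : exists G, forall (F1 F2 : rcfType)
    (e1 : {rmorphism B -> F1}) (e2 : {rmorphism B -> F2}),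
  same_signs e1 e2 G ->
  (exists x, all_pos (map (map_poly e1) sq) x) ->
  exists x, all_pos (map (map_poly e2) sq) x.
Proof.
have [G GP] := root_transfer (\prod_(q <- sq) q)^`() sq.
exists (G ++ flatten (map (@polyseq B) sq)) => F1 F2 e1 e2.
move=> /same_signs_cat[/GP {}GP ssq].
have sq_signs q : q \in sq -> same_signs e1 e2 q.
  by move=> qsq b bq; apply: ssq; apply/flattenP; exists (polyseq q) => //;
    apply: map_f.
have bound (F : rcfType) (e : {rmorphism B -> F}) :
  bounding_poly (map (map_poly e) sq) = map_poly e (\prod_(q <- sq) q)^`().
  by rewrite /bounding_poly big_map -deriv_map rmorph_prod.
have lead_signs (f : forall F : rcfType, {poly F} -> F) :
    (forall q, q \in sq ->
      sgz (f F1 (map_poly e1 q)) = sgz (f F2 (map_poly e2 q))) ->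
    \big[andb/true]_(q <- map (map_poly e1) sq) (0 < f F1 (q : {poly F1})) ->
    \big[andb/true]_(q <- map (map_poly e2) sq) (0 < f F2 (q : {poly F2})).
  move=> fs; rewrite !big_all !all_map => /allP pos; apply/allP => q qsq /=.
  by rewrite -sgz_gt0 -fs // sgz_gt0; apply: pos.
have lead1 := lead_signs (fun F (q : {poly F}) => lead_coef q)
  (fun q qsq => same_signs_lead_coef (sq_signs q qsq)).
move=> ex1.
suff : [\/ \big[andb/true]_(q <- map (map_poly e1) sq) (lead_coef q > 0),
      \big[andb/true]_(q <- map (map_poly e1) sq)
        ((-1)^+(size q).-1 * (lead_coef q) > 0) |
      map_poly e1 (\prod_(q <- sq) q)^`() != 0 /\
      exists2 x, (map_poly e1 (\prod_(q <- sq) q)^`()).[x] = 0 &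
        all_pos (map (map_poly e1) sq) x].
  move=> disj; suff [x] : exists x, \big[andb/true]_(q <- map (map_poly e2) sq)
    (q.[x] > 0) by rewrite big_all; exists x.
  apply/bounding_polyP; rewrite bound.
  case: disj => [/lead1|h|[b0 /(GP b0)[x x0 xsq]]]; first exact: Or31.
    apply: Or32; apply: (lead_signs (fun F (q : {poly F}) =>
      (-1) ^+ (size q).-1 * lead_coef q)) h.
    move=> q qsq; rewrite !sgzM !sgzX !sgzN !sgz1.
    by rewrite (same_signs_lead_coef (sq_signs q qsq)) (same_signs_size
      (sq_signs q qsq)).
  by apply: Or33; exists x; rewrite x0 eqxx big_all.
(* If the derivative is identically zero, the product is a nonzero constant; so is every factor,
   which then equals its leading coefficient. *)
have [b0|b0] := eqVneq (map_poly e1 (\prod_(q <- sq) q)^`()) 0; last first.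
  have /bounding_polyP : exists x, \big[andb/true]_(q <- map (map_poly e1) sq)
    (q.[x] > 0) by case: ex1 => x xsq; exists x; rewrite big_all.
  rewrite bound => -[h|h|[x /andP[/eqP x0]]]; [exact: Or31|exact: Or32|].
  by rewrite big_all => xsq; apply: Or33; split => //; exists x.
apply: Or31; rewrite big_all; case: ex1 => x /allP sqx.
have /size_prod_eq1 size1 : size (\prod_(q <- map (map_poly e1) sq) q) == 1%N.
  rewrite eqn_leq size_poly_gt0; apply/andP; split.
    by rewrite polyorder.derivn_poly0 derivn1 -/(bounding_poly _) bound b0.
  by rewrite prodf_seq_neq0; apply/allP => q /sqx; apply: contraTneq => ->;
    rewrite horner0 ltxx.
apply/allP => q qsq; have := sqx q qsq.
by rewrite [q]size1_polyC ?size1 // hornerC lead_coefC.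
Qed.

(** A sum of squares merges the equations into one; when it is the zero polynomial, only the
    inequalities remain. *)
Lemma system_transfer (zs sq : seq {poly B}) : exists G,
  forall (F1 F2 : rcfType)
    (e1 : {rmorphism B -> F1}) (e2 : {rmorphism B -> F2}), same_signs e1 e2 G ->
  forall x, all (fun q => (map_poly e1 q).[x] == 0) zs ->
    all_pos (map (map_poly e1) sq) x ->
  exists y, all (fun q => (map_poly e2 q).[y] == 0) zs /\
    all_pos (map (map_poly e2) sq) y.
Proof.
pose p := \sum_(q <- zs) q ^+ 2.
have zeroP (F : rcfType) (e : {rmorphism B -> F}) x :
    all (fun q => (map_poly e q).[x] == 0) zs = ((map_poly e p).[x] == 0).
  rewrite /p rmorph_sum horner_sum psumr_eq0 => [|q _]; last first.
    by rewrite rmorphXn horner_exp sqr_ge0.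
  by apply: eq_all => q /=; rewrite rmorphXn horner_exp sqrf_eq0.
have [G1 G1P] := root_transfer p sq; have [G2 G2P] := pos_transfer sq.
exists (G1 ++ G2 ++ p) => F1 F2 e1 e2 /same_signs_cat[/G1P {}G1P].
move=> /same_signs_cat[/G2P {}G2P sp] x; rewrite zeroP => /eqP x0 xsq.
have [p0|p0] := eqVneq (map_poly e1 p) 0.
  have [|y ysq] := G2P; first by exists x.
  exists y; rewrite zeroP; split=> //.
  suff -> : map_poly e2 p = 0 by rewrite horner0.
  by apply/eqP; rewrite -size_poly_eq0 -(same_signs_size sp) p0 size_poly0.
have [//||y y0 ysq] := G1P; first by exists x.
by exists y; rewrite zeroP y0.
Qed.

Lemma sign_vector_transfer (Q : seq {poly B}) : exists G,
  forall (F1 F2 : rcfType)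
    (e1 : {rmorphism B -> F1}) (e2 : {rmorphism B -> F2}), same_signs e1 e2 G ->
  forall x, exists y, {in Q, forall q,
    sgz (map_poly e1 q).[x] = sgz (map_poly e2 q).[y]}.
Proof.
(* The polynomials of known sign are moved to zs or, up to sign, to sq. *)
suff: forall zs sq : seq {poly B}, exists G, forall (F1 F2 : rcfType)
    (e1 : {rmorphism B -> F1}) (e2 : {rmorphism B -> F2}), same_signs e1 e2 G ->
  forall x, all (fun q => (map_poly e1 q).[x] == 0) zs ->
    all_pos (map (map_poly e1) sq) x ->
  exists y, [/\ all (fun q => (map_poly e2 q).[y] == 0) zs,
    all_pos (map (map_poly e2) sq) y &
    {in Q, forall q, sgz (map_poly e1 q).[x] = sgz (map_poly e2 q).[y]}].
  move=> /(_ [::] [::])[G GP]; exists G => F1 F2 e1 e2 /GP {}GP x.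
  by have [//|//|y [_ _ yQ]] := GP x; exists y.
elim: Q => [|q Q IHQ] zs sq.
  have [G GP] := system_transfer zs sq;
    exists G => F1 F2 e1 e2 /GP {}GP x zx sx.
  by have [y [zy sy]] := GP x zx sx; exists y.
have [G1 G1P] := IHQ (q :: zs) sq; have [G2 G2P] := IHQ zs (q :: sq).
have [G3 G3P] := IHQ zs (- q :: sq).
exists (G1 ++ G2 ++ G3) => F1 F2 e1 e2 /same_signs_cat[/G1P {}G1P].
move=> /same_signs_cat[/G2P {}G2P /G3P {}G3P] x zx sx.
have [q0|q0|q0] := ltrgt0P (map_poly e1 q).[x].
- have [//||y [zy /= /andP[qy sy] yQ]] := G2P x; first by rewrite /= q0.
  exists y; split=> // u; rewrite inE => /orP[/eqP->|/yQ//].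
  by rewrite (gtr0_sgz q0) (gtr0_sgz qy).
- have [//||y [zy /= /andP[qy sy] yQ]] := G3P x.
    by rewrite /= rmorphN hornerN oppr_gt0 q0.
  exists y; split=> // u; rewrite inE => /orP[/eqP->|/yQ//].
  by rewrite rmorphN hornerN oppr_gt0 in qy;
    rewrite (ltr0_sgz q0) (ltr0_sgz qy).
have [||y [/= /andP[/eqP qy zy] sy yQ]] := G1P x; rewrite //= ?q0 ?eqxx //.
exists y; split=> // u; rewrite inE => /orP[/eqP->|/yQ//].
by rewrite q0 qy !sgz0.
Qed.

End Uniform.

(** * Several variables and the Artin-Lang theorem *)

Lemma mpoly_rmorph_ext (R : comNzRingType) (S : comNzRingType) n
    (phi psi : {rmorphism {mpoly R[n]} -> S}) :
  (forall c, phi c%:MP = psi c%:MP) -> (forall i, phi 'X_i = psi 'X_i) ->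
  phi =1 psi.
Proof.
move=> eqC eqX; elim/mpolyind => [|c m p _ _ IHp]; first by rewrite !rmorph0.
rewrite !rmorphD IHp -mul_mpolyC !rmorphM eqC mpolyXE_id !rmorph_prod.
congr (_ * _ + _); apply: eq_bigr => i _.
by rewrite !rmorphXn; congr (_ ^+ _); apply: eqX.
Qed.

Lemma muniX_max (R : comNzRingType) n :
  muni ('X_ord_max : {mpoly R[n.+1]}) = 'X.
Proof.
rewrite /muni mmapX mmap1U; case: splitP => // j /= e.
by have := ltn_ord j; rewrite -e ltnn.
Qed.

Lemma muniX_widen (R : comNzRingType) n (i : 'I_n) :
  muni ('X_(widen_ord (leqnSn n) i) : {mpoly R[n.+1]}) = ('X_i)%:P.
Proof.
rewrite /muni mmapX mmap1U; case: splitP => [j /= e|j /= e].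
  by congr ('X__)%:P; apply/val_inj.
by have := ltn_ord i; rewrite e ord1 addn0 ltnn.
Qed.

Lemma muni_eval (R : comNzRingType) (S : comNzRingType) n
    (phi : {rmorphism {mpoly R[n.+1]} -> S}) q :
  (map_poly (phi \o @mwiden _ _) (muni q)).[phi 'X_ord_max] = phi q.
Proof.
pose psi := horner_eval (phi 'X_ord_max) \o
  (map_poly (phi \o @mwiden _ _) \o @muni n R).
apply: (@mpoly_rmorph_ext _ _ _ psi) => [c|i].
  by rewrite /psi /= muniC map_polyC /= /horner_eval hornerC mwidenC.
rewrite /psi /= /horner_eval; have [j|] := unliftP ord_max i.
  move=> ->; have -> : lift ord_max j = widen_ord (leqnSn n) j.
    by apply: val_inj; rewrite /= /bump leqNgt ltn_ord.
  rewrite muniX_widen map_polyC hornerC /= mwidenX mnmwiden1.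
  by [].
by move=> ->; rewrite muniX_max map_polyX hornerX.
Qed.

(** Positive elements of a real closed field are squares, so any ring morphism to [F] preserves the
    order. *)
Lemma rcf_rmorph_sgz (R F : rcfType) (iota : {rmorphism R -> F}) c :
  sgz (iota c) = sgz c.
Proof.
have pos d : 0 < d -> 0 < iota d.
  move=> d0; rewrite -[d]sqr_sqrtr ?ltW // rmorphXn lt0r sqr_ge0 andbT.
  by rewrite expf_neq0 // fmorph_eq0 sqrtr_eq0 -ltNge.
case: (ltrgt0P c) => [c0|c0|->]; last by rewrite rmorph0 !sgz0.
  by rewrite (gtr0_sgz c0) gtr0_sgz ?pos.
rewrite (ltr0_sgz c0) ltr0_sgz // -oppr_gt0 -rmorphN pos // oppr_gt0.
by [].
Qed.

(** One variable at a time: seen as polynomials in the last variable, the members of [Q] have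
    coefficients in the others. The induction hypothesis replaces the images of those variables by a
    real point with the same signs on the finite list [G], and [sign_vector_transfer] then replaces
    the image of the last variable. *)
Theorem artin_lang (R F : rcfType) n (phi : {rmorphism {mpoly R[n]} -> F})
    (Q : seq {mpoly R[n]}) :
  exists y : 'I_n -> R, {in Q, forall q, sgz (phi q) = sgz q.@[y]}.
Proof.
elim: n phi Q => [|n IHn] phi Q.
  exists (fun=> 0) => q _.
  have -> : q = (q@_0)%:MP.
    apply/mpolyP => m; rewrite mcoeffC (_ : m = 0%MM) ?eqxx ?mulr1 //.
    by apply/mnmP => -[].
  by rewrite mevalC; apply: (rcf_rmorph_sgz (phi \o @mpolyC _ _)).
have [G GP] := sign_vector_transfer (map (@muni n R) Q).
have [y yP] := IHn (phi \o @mwiden _ _) G.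
have [t tP] := GP _ _ (phi \o @mwiden _ _) (meval y) yP (phi 'X_ord_max).
pose z (i : 'I_n.+1) := if unlift ord_max i is Some j then y j else t.
exists z => q qQ.
rewrite -muni_eval tP ?map_f // -[q.@[z]]muni_eval; congr sgz.
rewrite /= mevalXU {2}/z unlift_none; congr (horner _ t).
apply: eq_map_poly; apply: mpoly_rmorph_ext => [c|i] /=.
  by rewrite mwidenC !mevalC.
rewrite mwidenX mnmwiden1 !mevalXU /z.
have -> : widen_ord (leqnSn n) i = lift ord_max i.
  by apply: val_inj; rewrite /= /bump leqNgt ltn_ord.
by rewrite liftK.
Qed.

(** * The Positivstellensatz *)

Section Preordering.
Variable A : comNzRingType.

Definition sos (a : A) : Prop := exists s : seq A, a = \sum_(b <- s) b ^+ 2.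

Lemma sos0 : sos 0.
Proof. by exists [::]; rewrite big_nil. Qed.

Lemma sos_sqr a : sos (a ^+ 2).
Proof. by exists [:: a]; rewrite big_seq1. Qed.

Lemma sosD a b : sos a -> sos b -> sos (a + b).
Proof. by move=> [s ->] [t ->]; exists (s ++ t); rewrite big_cat. Qed.

Lemma sosM a b : sos a -> sos b -> sos (a * b).
Proof.
move=> [s ->] [t ->]; exists [seq x * y | x <- s, y <- t].
rewrite big_allpairs_dep big_distrlr /=; apply: eq_bigr => x _.
by apply: eq_bigr => y _; rewrite exprMn.
Qed.

Section Generated.
Variables (I : finType) (f : I -> A).

Definition preordering (a : A) : Prop := exists q : {set I} -> A,
  (forall S, sos (q S)) /\ a = \sum_(S : {set I}) q S * \prod_(i in S) f i.

Lemma preordering0 : preordering 0.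
Proof.
exists (fun=> 0); split=> [S|]; first exact: sos0.
by rewrite big1 // => S _; rewrite mul0r.
Qed.

Lemma preorderingD a b : preordering a -> preordering b -> preordering (a + b).
Proof.
move=> [q [qS ->]] [q' [qS' ->]]; exists (fun S => q S + q' S).
split=> [S|]; first exact: sosD.
by rewrite -big_split; apply: eq_bigr => S _; rewrite mulrDl.
Qed.

Lemma preordering_term a (S : {set I}) : sos a ->
  preordering (a * \prod_(i in S) f i).
Proof.
move=> aS; exists (fun S' => if S' == S then a else 0); split=> [S'|].
  by case: ifP => // _; apply: sos0.
rewrite (bigD1 S) //= eqxx [X in _ + X]big1 ?addr0 // => S' /negbTE->.
by rewrite mul0r.
Qed.

(** Common factors become squares and can be absorbed in the sum-of-squares coefficient, so that
    products over subsets suffice. *)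
Lemma prod_symdiff (S T : {set I}) :
  (\prod_(i in S) f i) * (\prod_(i in T) f i) =
  (\prod_(i in S :&: T) f i) ^+ 2 * \prod_(i in (S :\: T) :|: (T :\: S)) f i.
Proof.
rewrite expr2 !(big_mkcond (fun i => i \in _)) -!big_split /=.
apply: eq_bigr => i _; rewrite !inE.
by case: (i \in S); case: (i \in T); rewrite /= ?mulr1 ?mul1r.
Qed.

Lemma preorderingM a b : preordering a -> preordering b -> preordering (a * b).
Proof.
move=> [q [qS ->]] [q' [qS' ->]]; rewrite big_distrlr /=.
apply: (big_ind preordering preordering0 preorderingD) => S _.
apply: (big_ind preordering preordering0 preorderingD) => T _.
rewrite mulrACA prod_symdiff mulrA; apply: preordering_term.
by apply: sosM (sos_sqr _); apply: sosM.
Qed.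

Lemma preordering_cone : cone preordering.
Proof.
split; [exact: preorderingD|exact: preorderingM|move=> a].
by have := preordering_term set0 (sos_sqr a); rewrite big_set0 mulr1.
Qed.

Lemma preordering_gen i : preordering (f i).
Proof.
have := preordering_term [set i] (sos_sqr 1).
by rewrite expr1n mul1r big_set1.
Qed.

Section Ideal.
Variables (J : finType) (h : J -> A).

Definition preordering_ideal (a : A) : Prop := exists b (rho : J -> A),
  preordering b /\ a = b + \sum_j rho j * h j.

Lemma preordering_ideal_cone : cone preordering_ideal.
Proof.
split=> [_ _ [b [rho [bP ->]]] [b' [rho' [bP' ->]]] |
         _ _ [b [rho [bP ->]]] [b' [rho' [bP' ->]]] | a].
- exists (b + b'), (fun j => rho j + rho' j); split; first exact: preorderingD.
  rewrite addrACA -big_split /=; congr (_ + _).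
  by apply: eq_bigr => j _; rewrite mulrDl.
(* Expanded as (b + u) (b' + v) = b b' + u (b' + v) + b v, where u and v are the ideal parts. *)
- exists (b * b'), (fun j => rho j * (b' + \sum_j rho' j * h j) + b * rho' j).
  split; first exact: preorderingM.
  under [in RHS]eq_bigr do rewrite mulrDl mulrAC -(mulrA b).
  rewrite big_split /= -mulr_suml -mulr_sumr.
  by set u := \sum_j _; set v := \sum_j _; ring.
exists (a ^+ 2), (fun=> 0); split; first exact: (cone_sqr preordering_cone).
by rewrite big1 ?addr0 // => j _; rewrite mul0r.
Qed.

Lemma preordering_ideal_gen i : preordering_ideal (f i).
Proof.
exists (f i), (fun=> 0); split; first exact: preordering_gen.
by rewrite big1 ?addr0 // => j _; rewrite mul0r.
Qed.

Lemma preordering_ideal_mul a j : preordering_ideal (a * h j).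
Proof.
exists 0, (fun j' => if j' == j then a else 0); split;
  first exact: preordering0.
rewrite (bigD1 j) //= eqxx big1 ?addr0 ?add0r // => j' /negbTE->.
by rewrite mul0r.
Qed.

End Ideal.
End Generated.
End Preordering.

Theorem positivstellensatz (R : rcfType) n (I J : finType)
    (f : I -> {mpoly R[n]}) (h : J -> {mpoly R[n]}) (g : {mpoly R[n]}) :
  (forall x : 'I_n -> R, (forall i, 0 <= (f i).@[x]) ->
    (forall j, (h j).@[x] = 0) -> g.@[x] = 0) ->
  exists k, preordering_ideal f h (- g ^+ (2 * k)).
Proof.
move=> empty; apply: boolp.contrapT => no.
have [|P [P0P Pprime Pg]] := prime_cone_extension (g :=
  g) (preordering_ideal_cone f h).
  by move=> k gk; apply: no; exists k.
have [K [e eP]] := prime_cone_field Pprime.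
have [F [e' e'P]] := real_closed_extension K.
pose phi : {rmorphism {mpoly R[n]} -> F} := e' \o e.
have phi_ge0 a : preordering_ideal f h a -> 0 <= phi a by move=> /P0P/eP/e'P.
have [y yP] := artin_lang phi (g ::
  [seq f i | i <- enum I] ++ [seq h j | j <- enum J]).
have gy : g.@[y] = 0.
  apply: empty => [i|j].
    rewrite -sgz_ge0 -yP ?sgz_ge0; first by apply/phi_ge0/preordering_ideal_gen.
    by rewrite inE mem_cat map_f ?orbT // mem_enum.
  apply/eqP; rewrite -sgz_eq0 -yP ?sgz_eq0; last first.
    by rewrite inE mem_cat map_f ?orbT // mem_enum.
  rewrite eq_le -oppr_ge0 -rmorphN; apply/andP; split; apply: phi_ge0.
    by have := preordering_ideal_mul f h (-1) j; rewrite mulN1r.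
  by have := preordering_ideal_mul f h 1 j; rewrite mul1r.
(* As g vanishes at the real point, its image in the real closed field is 0, and by injectivity of
   [e'] already its image in [K]; then - g^2 is in [P], a contradiction. *)
apply: Pg; apply/eP; rewrite rmorphN rmorphXn.
suff -> : e g = 0 by rewrite expr0n oppr0.
have : sgz (phi g) == 0 by rewrite yP ?inE ?eqxx // gy sgz0.
by rewrite sgz_eq0 /= fmorph_eq0 => /eqP.
Qed.

(** * Evaluating the certificate polynomials at real points *)

Section LiftedEvaluation.
Variables (R : realType) (n p m : nat).
Implicit Types (x : 'cV[R]_n) (y : 'cV[R]_m).

Definition point x y (i : 'I_(n + m)) : R := col_mx x y i 0.

Lemma meval_liftx x y (q : {mpoly R[n]}) :
  (liftx m q).@[point x y] = q.@[fun i => x i 0].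
Proof.
rewrite /liftx comp_mpoly_meval; apply: meval_eq => i.
by rewrite tnth_mktuple mevalXU /point col_mxEu.
Qed.

Lemma meval_yvar x y j : (yvar R n m j 0).@[point x y] = y j 0.
Proof. by rewrite mxE mevalXU /point col_mxEd. Qed.

Variables (f : 'cV[{mpoly R[n]}]_n) (g : 'M[{mpoly R[n]}]_(n, p)).
Variables (L : 'I_m -> 'M[R]_p) (d : 'I_m -> nat) (H : 'I_m -> nat ->
  {mpoly R[n]}).

Lemma meval_ATy x y i :
  (ATy g L d H i 0).@[point x y] = ((evalmx (hocbfA g L d H) x)^T *m y) i 0.
Proof.
rewrite /ATy !mxE rmorph_sum; apply: eq_bigr => j _ /=.
by rewrite rmorphM /= meval_yvar mxE [map_mx _ _ _ _]mxE meval_liftx !mxE.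
Qed.

Lemma meval_negXiTy x y :
  (negXiTy f d H).@[point x y] = - ((evalmx (hocbfXi f d H) x)^T *m y) 0 0.
Proof.
rewrite /negXiTy !mxE rmorphN rmorph_sum; congr (- _); apply: eq_bigr => j _ /=.
by rewrite rmorphM /= meval_yvar mxE [map_mx _ _ _ _]mxE meval_liftx !mxE.
Qed.

Lemma phis_ge0P x y :
  (forall i : 'I_(size (phis f d H)), 0 <= ((phis f d H)`_i).@[point x y]) <->
  [/\ forall j, 0 <= y j 0, 0 <= (negXiTy f d H).@[point x y] &
      forall j k, (k <= d j)%N -> 0 <= (H j k).@[fun i => x i 0]].
Proof.
have memP : (forall i :
  'I_(size (phis f d H)), 0 <= ((phis f d H)`_i).@[point x y])
    <-> {in phis f d H, forall q, 0 <= q.@[point x y]}.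
  split=> [h q qphi|h i]; last by apply: h; rewrite mem_nth.
  by rewrite -(nth_index 0 qphi); apply: (h (Ordinal _)); rewrite index_mem.
rewrite memP; split=> [h|[y0 xi0 H0] q].
  split=> [j||j k kd].
  - rewrite -(meval_yvar x); apply: h; rewrite mem_cat; apply/orP; left.
    by apply/mapP; exists j; rewrite ?mem_enum.
  - by apply: h; rewrite mem_cat inE eqxx orbT.
  rewrite -(meval_liftx x y); apply: h; rewrite mem_cat inE; apply/or3P;
    apply: Or33.
  apply/flatten_mapP; exists j; rewrite ?mem_enum //.
  by apply/mapP; exists k; rewrite ?mem_iota ?add0n ?ltnS.
rewrite mem_cat inE =>
  /or3P[/mapP[j _ ->]|/eqP->//|/flatten_mapP[j _ /mapP[k + ->]]].
  by rewrite meval_yvar.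
by rewrite mem_iota add0n ltnS /= meval_liftx; apply: H0.
Qed.

End LiftedEvaluation.

Theorem lemma9 (R : realType) (n p m : nat) (m_gt0 : (0 < m)%N)
    (f : 'cV[{mpoly R[n]}]_n) (g : 'M[{mpoly R[n]}]_(n, p)) (h : {mpoly R[n]})
    (L : 'I_m -> 'M[R]_p)
    (L_pattern : forall j : 'I_m, failure_pattern (L j))
    (L_controllable : forall j : 'I_m,
       Control.controllable (evalmx f) (fun x => evalmx g x *m L j))
    (d' : 'I_m -> nat) (H : 'I_m -> nat -> {mpoly R[n]})
    (H_high_order : forall j : 'I_m,
       high_order_functions f g h (L j) (d' j) (H j))
    (H_degree : forall j : 'I_m, relative_degree g (L j) (H j) (d' j)) :
  let A := hocbfA g L d' H in
  let Xi := hocbfXi f d' H in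
  let phi_ := phis f d' H in
  (forall x : 'cV[R]_n,
     (forall (j : 'I_m) (k : nat), (k <= d' j)%N ->
        0 <= (H j k).@[fun i => x i 0]) ->
     exists u : 'cV[R]_p,
       forall j : 'I_m, (evalmx A x *m u) j 0 <= evalmx Xi x j 0)
  <->
  (exists (rho : 'I_p -> 'I_m -> {mpoly R[n + m]})
          (q : {set 'I_(size phi_)} -> {mpoly R[n + m]})
          (r : 'I_m -> nat),
     (forall S : {set 'I_(size phi_)}, sum_of_squares (q S)) /\
     let phi := \sum_(S : {set 'I_(size phi_)}) q S * \prod_(i in S) phi_`_i in
     let chi := \prod_(j < m) (negXiTy f d' H) ^+ (2 * r j) in
     let psi := \sum_(j < m) \sum_(i < p)
                  rho i j * ATy g L d' H i 0 in
     phi + chi + psi = 0).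
Proof.
move=> A Xi phi_; split=> [feasible|[rho [q [r [qS /= identity]]]] x xH].
  pose j0 := Ordinal m_gt0.
  have [z|k [a [rho [[q [qS aE]] e]]]] :=
      @positivstellensatz R (n + m) 'I_(size phi_) 'I_p
        (fun i => phi_`_i) (fun i => ATy g L d' H i 0) (negXiTy f d' H).
    pose x : 'cV[R]_n := \col_i z (lshift m i).
    pose y : 'cV[R]_m := \col_j z (rshift n j).
    have zE : z =1 point x y.
      move=> i; rewrite /point -[i]splitK; case: (split i) => j /=.
        by rewrite col_mxEu mxE.
      by rewrite col_mxEd mxE.
    move=> phi0 ATy0; rewrite (meval_eq _ zE) meval_negXiTy.
    have [|y0 xi0 H0] := (phis_ge0P f d' H x y).1.
      by move=> i; rewrite -(meval_eq _ zE); apply: phi0.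
    rewrite meval_negXiTy in xi0.
    have [u uP] := feasible x H0.
    (* From A u <= Xi and y >= 0 follows 0 = u^T A^T y <= Xi^T y, while - Xi^T y >= 0 is among the
       constraints. *)
    apply/eqP; rewrite eq_le xi0 andbT oppr_le0.
    have -> : 0 = ((evalmx A x *m u)^T *m y) 0 0.
      have Ay : (evalmx A x)^T *m y = 0.
        by apply/colP => i; rewrite -meval_ATy -(meval_eq _ zE) ATy0 mxE.
      by rewrite trmx_mul -mulmxA Ay mulmx0 mxE.
    rewrite !mxE ler_sum // => j _.
    rewrite ler_wpM2r // [X in X <= _]mxE [X in _ <= X]mxE; exact: uP.
  (* Neither the base of the power nor [A^T y]_i depends on j, so the exponent and the multipliers
     can all be placed at the single index [j0]. *)
  exists (fun i j => if j == j0 then rho i else 0), q.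
  exists (fun j => if j == j0 then k else 0%N); split=> // /=.
  rewrite (bigD1 j0) //= [X in _ * X]big1 => [|j /negbTE->];
    last by rewrite muln0 expr0.
  rewrite [X in _ + X](bigD1 j0) //= [X in _ + (_ + X)]big1 => [|j /negbTE jj].
    by rewrite mulr1 addr0 -aE addrAC -e addNr.
  by rewrite big1 // => i _; rewrite jj mul0r.
have [//|[y [y0 Ay0 xi0]]] := farkas (evalmx A x) (evalmx Xi x).
(* At (x, y), with y from Farkas' lemma, phi >= 0, chi > 0 and psi = 0, which contradicts the
   identity. *)
exfalso; pose z := point x y.
have negXi : 0 < (negXiTy f d' H).@[z] by rewrite meval_negXiTy oppr_gt0.
have phi0 : forall i : 'I_(size phi_), 0 <= (phi_`_i).@[z].
  by apply/phis_ge0P; split=> //; apply: ltW.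
have := congr1 (meval z) identity; rewrite rmorph0 !rmorphD !rmorph_sum /=.
rewrite [X in _ + X]big1 => [|j _]; last first.
  rewrite rmorph_sum big1 // => i _.
  by rewrite rmorphM /= [X in _ * X]meval_ATy Ay0 mxE mulr0.
apply/eqP; rewrite addr0 gt_eqF // ltr_wpDl //.
  apply: sumr_ge0 => S _; rewrite rmorphM rmorph_prod mulr_ge0 //.
    have [s ->] := qS S; rewrite rmorph_sum sumr_ge0 // => b _.
    by rewrite rmorphXn sqr_ge0.
  by apply: prodr_ge0 => i _; apply: phi0.
by rewrite rmorph_prod prodr_gt0 // => j _; rewrite rmorphXn exprn_gt0.
Qed.
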